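(* For every integer $N\ge 1$ one has $\varTheta_{N,0}(\mathbb{S})=1$. Moreover, there is an absolute constant $K>1$ (independent of $N$ and $\beta$) such that for every integer $N\ge1$ and every real $\beta>0$, $$1\le \varTheta_{N,\beta}(\mathbb{S})\le K^{\beta}.$$
   Context: Let $\mathrm{dA}(z)=\mathrm{d}x\,\mathrm{d}y$ be area measure on $\mathbb{C}$ ($z=x+\mathrm{i}y$), and let $\mathrm{dA}_{\mathbb{S}}(z)=\frac{\mathrm{dA}(z)}{(1+|z|^2)^2}$ be the area measure of the Riemann sphere $\mathbb{S}=\mathbb{C}\cup\{\infty\}$ (total mass $\pi$). For $z,w\in\mathbb{C}$ let $$U_{\mathbb{S}}(z,w)=\frac12+\frac12\log\frac{|z-w|^2}{(1+|z|^2)(1+|w|^2)}$$ (with value $-\infty$ if $z=w$). For an integer $N\ge1$ and real $\beta>-2$, the packing number is $$\varTheta_{N,\beta}(\mathbb{S})=\inf_{w_1,\ldots,w_N\in\mathbb{C}}\frac1\pi\int_{\mathbb{C}}\exp\big(\beta U_{\mathbb{S}}(z,w_1)+\cdots+\beta U_{\mathbb{S}}(z,w_N)\big)\,\mathrm{dA}_{\mathbb{S}}(z).$$ *)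

(* Defs.v *)
From HB Require Import structures.
From mathcomp Require Import all_boot all_order all_algebra.
From mathcomp Require Import complex.
From mathcomp Require Import all_classical all_reals all_analysis.
Set Implicit Arguments.
Unset Strict Implicit.
Unset Printing Implicit Defensive.
Import Order.TTheory GRing.Theory Num.Theory.
Import numFieldNormedType.Exports.
Import Normc.

Local Open Scope classical_set_scope.
Local Open Scope ring_scope.
Local Open Scope complex_scope.
Local Open Scope ereal_scope.

(* The points of the plane are the complex numbers [R[i]], but [R[i]] carries no
   measurable structure in the libraries: dA = dx dy is the product Lebesgue
   measure on [R * R], and a function on [R[i]] is integrated through
   (x, y) |-> x + iy. *)
Definition integral_dA (R : realType) (F : R[i] -> \bar R) : \bar R :=
  \int[(@lebesgue_measure R) \x (@lebesgue_measure R)]_p F (p.1 +i* p.2).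

(* Integration against dA_S = dA / (1 + |z|^2)^2, the area of the Riemann sphere;
   the point at infinity has measure zero. *)
Definition integral_dAS (R : realType) (F : R[i] -> \bar R) : \bar R :=
  integral_dA (fun z => F z * (((1 + normc z ^+ 2) ^+ 2)^-1)%R%:E).

(* [lne] sends 0 to -oo, so [US z z = -oo]. *)
Definition US (R : realType) (z w : R[i]) : \bar R :=
  (2^-1)%R%:E + (2^-1)%R%:E *
    lne ((normc (z - w) ^+ 2 / ((1 + normc z ^+ 2) * (1 + normc w ^+ 2)))%R%:E).

(* The condition beta > -2, under which the infimum is finite, is not imposed here.
   Since each [US] is < +oo, the sum never mixes +oo and -oo.  For beta = 0 the convention
   0 * -oo = 0 makes the integrand 1 everywhere; it only matters on the null set
   of the [w i]. *)
Definition packing_number (R : realType) (N : nat) (beta : R) : \bar R :=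
  ereal_inf [set (pi^-1)%R%:E *
      integral_dAS (fun z => expeR (\sum_(i < N) beta%:E * US z (w i)))
    | w in [set: 'I_N -> R[i]]].

(* Main.v *)
Require Import Defs.
From mathcomp Require Import all_boot all_order all_algebra.
From mathcomp Require Import complex.
From mathcomp Require Import all_classical all_reals all_analysis.
From mathcomp Require Import measurable_realfun.
From mathcomp Require Import zify ring lra.
Set Implicit Arguments.
Unset Strict Implicit.
Unset Printing Implicit Defensive.
Import Order.TTheory GRing.Theory Num.Theory.
Import numFieldNormedType.Exports.
Import Normc.
Local Open Scope classical_set_scope.
Local Open Scope ring_scope.

(** The squared chordal distance
    d(z, w) = |z - w|^2 / ((1 + |z|^2) (1 + |w|^2))
    is uniformly distributed on [0, 1] when z is uniform on the sphere.  Hence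
    U(z, w) = (1 + log d(z, w)) / 2 has mean zero in z for every w, and the
    integrand of the packing number is the product of the (e d(z, w_i))^(beta / 2).

    Lower bound.  Since exp f >= 1 + f, it is enough that the sum of the
    beta U(., w_i) has mean zero, that is, that - log d(., w) has integral pi
    ([sphere_log_chord]).  By rotation invariance of the sphere one could move w
    to infinity, where - log d becomes log (1 + |z|^2).  The rotation is applied as a
    chain of elementary substitutions: a translation sends w to 0, the inversion
    z |-> 1 / conj z sends 0 to infinity, and a translation and a dilation restore
    the standard form of the measure.  All integrands are nonnegative, so Tonelli
    reduces each substitution to the line.  The inversion is done in
    the coordinates z = x (1 + i t), in which it is x |-> 1 / ((1 + t^2) x) on each
    line of slope t ([area_slope], [area_inversion]).

    Upper bound.  It is enough to find, for every N, points w_i for which the sum of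
    the U(., w_i) is at most an absolute constant ([flat_configuration]).  The
    height t = |z|^2 / (1 + |z|^2) is uniform on [0, 1].  Write N = 2 m^2 + r
    with r <= 4 m + 1, cut the southern part of [0, 1] at the heights
    T_i = i^2 / N, and put on one parallel between T_i and T_(i+1) a regular
    polygon of 2 i + 1 points; mirror this in the north and put the r remaining
    points on the equator.  A polygon of n points at height s contributes to the sum
    of log d essentially n log max(t (1 - s), s (1 - t)), so the sum over the
    polygons is N times a quadrature of the integral over s in [0, 1] of
    log max(t (1 - s), s (1 - t)), whose value is -1 for every t.
    Three things must be checked.
    - The quadrature error is bounded from above.  The height s_i of the polygon
      satisfies s_i^2 = T_i T_(i+1) (for i > 0), so that log s_i is the mean of the values
      of log at the ends of the interval and lies below the mean of log over it
      ([lnint_trapezoid]); and log (1 - s_i) is too large by only O(1 / N),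
      an error that sums to O(1) over the N points.
    - When k southern rings lie below height t, the idealized sum depends on t
      through k^2 log t + (N - k^2) log (1 - t), which is largest at t = T_k.
    - A polygon exceeds its idealized contribution by at most the factor
      (1 + x^n)^2, where x <= 1 is the ratio of the radii of the two circles, and these
      x^n decrease geometrically away from z ([overlap_below],
      [overlap_above]).
    The estimate is needed for t <= 1/2 only, because the configuration is symmetric
    under t |-> 1 - t ([parallels_half], [parallels_sym]). *)

(** * Integrals over the line and the plane *)

Section PlaneIntegrals.
Context {R : realType}.
Local Notation mu := (@lebesgue_measure R).
Local Open Scope ereal_scope.
Implicit Types (f : R -> \bar R) (F : R * R -> \bar R).

(** A measure that agrees with the Lebesgue measure on the intervals ]a, b] is equal to it;
    this gives the substitutions of the line below without any regularity of the integrand. *)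
Lemma integral_pushforward_eq (phi : R -> R) (c : {nonneg R}) f :
  measurable_fun [set: R] phi ->
  (forall a b : R, (a < b)%R -> mu `]a, b] = c%:num%:E * mu (phi @^-1` `]a, b])) ->
  measurable_fun [set: R] f -> (forall x, 0 <= f x) ->
  \int[mu]_x f x = c%:num%:E * \int[mu]_x f (phi x).
Proof.
move=> mphi muE mf f0.
pose phi' : measurableTypeR R -> measurableTypeR R := phi.
have mphi' : measurable_fun [set: measurableTypeR R] phi' by exact: mphi.
pose nu : {measure set (measurableTypeR R) -> \bar R} :=
  mscale c (measure_function_pushforward__canonical__measure_function_Measure mu mphi').
have munu A : measurable A -> mu A = nu A.
  apply: lebesgue_measure_unique => _ [[a b]] _ <-.
  change (mu `]a, b]%classic = c%:num%:E * mu (phi @^-1` `]a, b]%classic)).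
  have [ab|ba] := ltP a b; first exact: muE.
  by rewrite set_itv_ge ?bnd_simp -?leNgt// preimage_set0 !measure0 mule0.
transitivity (\int[nu]_x f x).
  by apply: eq_measure_integral => A mA _; exact: munu.
rewrite ge0_integral_mscale//; congr (_ * _).
by rewrite ge0_integral_pushforward//.
Qed.

Lemma integral_translate (a : R) f :
  measurable_fun [set: R] f -> (forall x, 0 <= f x) ->
  \int[mu]_x f (x + a)%R = \int[mu]_x f x.
Proof.
move=> mf f0.
rewrite [RHS](@integral_pushforward_eq (fun x => x + a)%R (NngNum (@ler01 R)))//= ?mul1e//.
  exact: measurable_funD.
move=> u v uv; rewrite mul1e.
rewrite (_ : _ @^-1` _ = `](u - a)%R, (v - a)%R]%classic).
  by rewrite !lebesgue_measure_itv/= !lte_fin ltrD2r uv -!EFinB; congr EFin; ring.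
by apply/seteqP; split => x /=; rewrite !in_itv/= ltrBlDr lerBrDr.
Qed.

Lemma integral_scale (c : R) f : c != 0%R ->
  measurable_fun [set: R] f -> (forall x, 0 <= f x) ->
  `|c|%:E * \int[mu]_x f (c * x)%R = \int[mu]_x f x.
Proof.
move=> c0 mf f0.
have nc0 : (0 <= `|c|)%R by [].
rewrite [RHS](@integral_pushforward_eq (fun x => c * x)%R (NngNum nc0))//=; first exact: measurable_funM.
move=> u v uv; have [cp|cn|/eqP] := ltgtP c 0%R; last by rewrite (negbTE c0).
- rewrite (_ : _ @^-1` _ = `[(v / c)%R, (u / c)%R[%classic).
    rewrite !lebesgue_measure_itv/= !lte_fin ltr_nM2r ?invr_lt0// uv -!EFinB -EFinM.
    by congr EFin; rewrite ltr0_norm//; field.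
  apply/seteqP; split => x /=; rewrite !in_itv/=.
    by rewrite ler_ndivrMr// ltr_ndivlMr// mulrC andbC.
  by rewrite ler_ndivrMr// ltr_ndivlMr// mulrC andbC.
- rewrite (_ : _ @^-1` _ = `](u / c)%R, (v / c)%R]%classic).
    rewrite !lebesgue_measure_itv/= !lte_fin ltr_pM2r ?invr_gt0// uv -!EFinB -EFinM.
    by congr EFin; rewrite gtr0_norm//; field.
  by apply/seteqP; split => x /=; rewrite !in_itv/= ltr_pdivrMr// ler_pdivlMr// mulrC.
Qed.

Local Notation area := (mu \x mu).

Lemma area_translate (a b : R) F :
  measurable_fun [set: R * R] F -> (forall p, 0 <= F p) ->
  \int[area]_p F (p.1 + a, p.2 + b)%R = \int[area]_p F p.
Proof.
move=> mF F0.
have mG : measurable_fun [set: R * R] (fun p : R * R => F (p.1 + a, p.2 + b)%R).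
  apply: measurableT_comp => //; apply/measurable_fun_pairP.
  by split; apply: measurable_funD.
rewrite fubini_tonelli1// [RHS]fubini_tonelli1//.
rewrite -[RHS](integral_translate a)//; last 2 first.
- exact: measurable_fun_fubini_tonelli_F.
- by move=> x; exact: integral_ge0.
apply: eq_integral => x _; rewrite /fubini_F/=.
rewrite (@integral_translate b (fun y => F (x + a, y)%R))//.
exact: (measurable_fun_pair2 (x + a)%R mF).
Qed.

Lemma area_scale (c : R) F : c != 0%R ->
  measurable_fun [set: R * R] F -> (forall p, 0 <= F p) ->
  (c ^+ 2)%:E * \int[area]_p F (c * p.1, c * p.2)%R = \int[area]_p F p.
Proof.
move=> c0 mF F0.
have mG : measurable_fun [set: R * R] (fun p : R * R => F (c * p.1, c * p.2)%R).
  apply: measurableT_comp => //; apply/measurable_fun_pairP.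
  by split; apply: measurable_funM.
rewrite fubini_tonelli1// [RHS]fubini_tonelli1//.
rewrite -[RHS](integral_scale c0)//; last 2 first.
- exact: measurable_fun_fubini_tonelli_F.
- by move=> x; exact: integral_ge0.
rewrite -real_normK ?num_real// expr2 EFinM -muleA; congr (_ * _).
rewrite -ge0_integralZl//; last 2 first.
- exact: (measurable_fun_fubini_tonelli_F (m2 := mu) (fun p : R * R => F (c * p.1, c * p.2)%R)).
- by move=> x _; exact: integral_ge0.
apply: eq_integral => x _; rewrite /fubini_F/=.
rewrite (@integral_scale c (fun y => F (c * x, y)%R))//.
exact: (measurable_fun_pair2 (c * x)%R mF).
Qed.

(** In the coordinates z = x (1 + i t) the lines through the origin become the lines
    t = constant, and dx dy = |x| dx dt.  This replaces polar coordinates and only uses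
    dilations of the line. *)
Lemma area_slope F :
  measurable_fun [set: R * R] F -> (forall p, 0 <= F p) ->
  \int[area]_p F p = \int[mu]_t \int[mu]_x (`|x|%:E * F (x, x * t)%R).
Proof.
move=> mF F0.
pose G := fun p : R * R => `|p.1|%:E * F (p.1, p.1 * p.2)%R.
have mG : measurable_fun [set: R * R] G.
  apply: emeasurable_funM.
    by apply/measurable_EFinP; apply: measurableT_comp.
  apply: measurableT_comp => //; apply/measurable_fun_pairP; split.
    exact: measurable_fst.
  exact: measurable_funM.
have G0 p : 0 <= G p by rewrite mule_ge0.
transitivity (\int[mu]_x \int[mu]_t G (x, t)); last first.
  by rewrite (fubini_tonelli (m1 := mu) (m2 := mu) G).
rewrite fubini_tonelli1//.
apply: ae_eq_integral => //.
- exact: measurable_fun_fubini_tonelli_F.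
- exact: (measurable_fun_fubini_tonelli_F (m2 := mu) G).
exists [set 0%R]; split => //; first exact: lebesgue_measure_set1.
move=> x /= h; apply: contrapT => /eqP x0; apply: h => _; rewrite /fubini_F /G/=.
rewrite ge0_integralZl//; last first.
  apply: measurableT_comp => //; apply/measurable_fun_pairP; split.
    exact: measurable_cst.
  exact: measurable_funM.
rewrite (@integral_scale x (fun y => F (x, y)))//.
exact: (measurable_fun_pair2 x mF).
Qed.

End PlaneIntegrals.

(** * Inversion on the half-line *)

Section Inversion.
Context {R : realType}.
Local Notation mu := (@lebesgue_measure R).
Local Open Scope ereal_scope.

Lemma measurable_inv : measurable_fun [set: R] (@GRing.inv R).
Proof.
rewrite (_ : GRing.inv = fun x : R => (x * (x ^+ 2) `^ (-1))%R).
  apply: measurable_funM => //.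
  exact: (measurableT_comp (measurable_powR (-1)%R) (@exprn_measurable R setT 2)).
apply/funext => x; rewrite powR_inv1 ?sqr_ge0//.
have [->|x0] := eqVneq x 0%R; first by rewrite mul0r invr0.
by field.
Qed.

(** The substitution x |-> 1 / (k x) is decreasing and smooth on every segment
    [1 / (n + 1), n + 1]; these segments exhaust the half-line. *)
Lemma integral_inversion (k : R) (h : R -> R) : (0 < k)%R ->
  (forall x, 0 < x -> {for x, continuous h})%R ->
  (forall x, 0 < x -> 0 <= h x)%R ->
  \int[mu]_(x in `]0%R, +oo[) (h x)%:E =
  \int[mu]_(x in `]0%R, +oo[) (h (k * x)^-1 / (k * x ^+ 2))%:E.
Proof.
move=> k0 ch h0.
pose F (x : R) := (k * x)^-1%R.
have dF (x : R) : (0 < x)%R -> is_derive x 1%R F (- (k * x ^+ 2)^-1)%R.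
  move=> x0; have kx0 : (k * x != 0)%R by rewrite mulf_neq0 ?gt_eqF.
  have := @is_deriveV _ (fun x => k * x)%R x _ 1%R kx0 _.
  move=> /(_ _ (is_deriveZ _ _)) D.
  apply: is_derive_eq.
  rewrite /GRing.scale/= mulr1; field.
  by rewrite !gt_eqF.
have F'E (x : R) : (0 < x)%R -> F^`()%classic x = (- (k * x ^+ 2)^-1)%R.
  by move=> x0; rewrite derive1E; have /= -> := @derive_val _ _ _ _ _ _ _ (dF x x0).
have ckx2V (x : R) : (0 < x)%R -> {for x, continuous (fun y : R => (k * y ^+ 2)^-1)%R}.
  move=> x0; apply: continuousV; first by rewrite mulf_neq0 ?gt_eqF ?exprn_gt0.
  apply: continuousM; first exact: cst_continuous.
  exact: exprn_continuous.
have cF' (x : R) : (0 < x)%R -> F^`()%classic y @[y --> x] --> (- (k * x ^+ 2)^-1)%R.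
  move=> x0; apply: (@cvg_trans _ ((fun y : R => - (k * y ^+ 2)^-1)%R y @[y --> x])).
    apply: near_eq_cvg; near=> y; rewrite F'E//.
    by near: y; exact: lt_nbhsr.
  have := continuousN (ckx2V _ x0). exact.
have cF (x : R) : (0 < x)%R -> F y @[y --> x] --> F x.
  move=> x0; apply: continuousV; first by rewrite mulf_neq0 ?gt_eqF.
  exact: mulrl_continuous.
pose a n : R := (n.+1%:R)^-1%R; pose b n : R := n.+1%:R%R.
have a0 n : (0 < a n)%R by rewrite invr_gt0.
have b0 n : (0 < b n)%R by rewrite ltr0n.
have ab n : (a n <= b n)%R by rewrite /a /b (@le_trans _ _ 1%R)// ?invf_le1// ler1n.
pose h' x := (h (k * x)^-1 / (k * x ^+ 2))%R.
have ch' x : (0 < x)%R -> {for x, continuous h'}.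
  move=> x0; apply: continuousM; last exact: ckx2V.
  apply: (@continuous_comp _ _ _ F h); first exact: cF.
  by apply: ch; rewrite invr_gt0 mulr_gt0.
have h'0 x : (0 < x)%R -> (0 <= h' x)%R.
  by move=> x0; rewrite divr_ge0// ?h0// ?invr_gt0 ?mulr_gt0// mulr_ge0 ?ltW// exprn_gt0.
have subs n : \int[mu]_(x in `[F (b n), F (a n)]) (h x)%:E =
              \int[mu]_(x in `[a n, b n]) (h' x)%:E.
  have abpos (x : R) : x \in `[a n, b n] -> (0 < x)%R.
    by rewrite in_itv/= => /andP[/(lt_le_trans (a0 n))].
  have oopos (x : R) : x \in `]a n, b n[ -> (0 < x)%R.
    by rewrite in_itv/= => /andP[/(lt_trans (a0 n))].
  rewrite (@integration_by_substitution_decreasing R F h (a n) (b n))//.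
  - apply: eq_integral => x; rewrite inE/= => /abpos x0.
    by rewrite /h' !fctE F'E// opprK.
  - move=> x y /abpos x0 /abpos y0 xy.
    by rewrite /F ltf_pV2 ?posrE ?mulr_gt0// ltr_pM2l.
  - by move=> x /oopos x0; rewrite /continuous_at F'E//; exact: cF'.
  - by apply/cvg_ex; exists (- (k * a n ^+ 2)^-1)%R; apply: cvg_at_right_filter; exact: cF'.
  - by apply/cvg_ex; exists (- (k * b n ^+ 2)^-1)%R; apply: cvg_at_left_filter; exact: cF'.
  - split.
    + by move=> x /oopos x0; have [] := dF x x0.
    + by apply: cvg_at_right_filter; exact: cF.
    + by apply: cvg_at_left_filter; exact: cF.
  - apply: continuous_in_subspaceT => x; rewrite inE/= in_itv/= => /andP[Fx _].
    by apply: ch; apply: (lt_le_trans _ Fx); rewrite /F invr_gt0 mulr_gt0.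
have mcont (g : R -> R) (A : set R) : (forall x, 0 < x -> {for x, continuous g})%R ->
    A `<=` `]0%R, +oo[ -> measurable A -> measurable_fun A (fun x => (g x)%:E).
  move=> cg A0 mA; apply/measurable_EFinP.
  apply: (measurable_funS _ A0) => //.
  apply: open_continuous_measurable_fun; first exact: interval_open.
  by move=> x; rewrite inE/= in_itv/= andbT => x0; exact: cg.
have cup (u v : nat -> R) : (forall n, 0 < u n)%R -> u @ \oo --> 0%R -> v @ \oo --> +oo%R ->
    \bigcup_n `[u n, v n]%classic = `]0%R, +oo[%classic.
  move=> u0 uc vc; apply/seteqP; split => x /=.
    by move=> [n _] /=; rewrite !in_itv/= andbT => /andP[/(lt_le_trans (u0 n))].
  rewrite in_itv/= andbT => x0.
  near \oo => n; exists n => //=; rewrite in_itv/=; apply/andP; split.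
    near: n; move/cvgrPdist_le : uc => /(_ _ x0); apply: filterS => n.
    by rewrite sub0r normrN gtr0_norm.
  by near: n; move/cvgryPge : vc; exact.
have bc : b @ \oo --> +oo%R.
  apply/cvgryPge => A; near=> n; rewrite /b (@le_trans _ _ n%:R)// ?ler_nat//.
  by near: n; exact: nbhs_infty_ger.
have ac : a @ \oo --> 0%R.
  apply/gtr0_cvgV0; first exact: nearW.
  exact: bc.
have exhaust (g : R -> R) (u v : nat -> R) : (forall x, 0 < x -> {for x, continuous g})%R ->
    (forall x, 0 < x -> 0 <= g x)%R -> (forall n, 0 < u n)%R ->
    {homo u : m n / (m <= n)%N >-> (n <= m)%R} -> {homo v : m n / (m <= n)%N >-> (m <= n)%R} ->
    u @ \oo --> 0%R -> v @ \oo --> +oo%R ->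
    \int[mu]_(x in `[u n, v n]) (g x)%:E @[n --> \oo] --> \int[mu]_(x in `]0%R, +oo[) (g x)%:E.
  move=> cg g0 u0 du iv uc vc; rewrite -(cup u v)//.
  have sub n : `[u n, v n] `<=` `]0%R, +oo[.
    by move=> x /=; rewrite !in_itv/= andbT => /andP[/(lt_le_trans (u0 n))].
  apply: ge0_nondecreasing_set_cvg_integral => //.
  - move=> m n mn; rewrite subsetEset => x /=; rewrite !in_itv/= => /andP[ux xv].
    by rewrite (le_trans (du _ _ mn) ux) (le_trans xv (iv _ _ mn)).
  - by move=> n; exact: mcont.
  - move=> n x /sub; rewrite /= in_itv/= andbT => x0.
    by rewrite lee_fin g0.
have L1 := exhaust h' a b ch' h'0 a0 _ _ ac bc.
have L2 := exhaust h (F \o b) (F \o a) ch h0 _ _ _ _ _.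
apply: (@cvg_unique _ _ (\int[mu]_(x in `[F (b n), F (a n)]) (h x)%:E @[n --> \oo])) => //.
  apply: L2.
  - by move=> n; rewrite /F/= invr_gt0 mulr_gt0.
  - move=> m n mn /=; rewrite /F lef_pV2 ?posrE ?mulr_gt0//.
    by rewrite ler_pM2l// ler_nat ltnS.
  - move=> m n mn /=; rewrite /F lef_pV2 ?posrE ?mulr_gt0//.
    by rewrite ler_pM2l// /a lef_pV2 ?posrE ?ltr0n// ler_nat ltnS.
  - rewrite (_ : F \o b = (fun n => k^-1 * a n)%R).
      by rewrite -(mulr0 (k^-1)%R); exact: (cvgM (cvg_cst _) ac).
    by apply/funext => n; rewrite /F /= invfM.
  - rewrite (_ : F \o a = (fun n => k^-1 * b n)%R).
      apply/cvgryPge => A; move/cvgryPge : bc => /(_ (k * A)%R).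
      by apply: filterS => n; rewrite ler_pdivlMl.
    by apply/funext => n; rewrite /F /= invfM invrK.
rewrite (_ : (fun n => _) = (fun n => \int[mu]_(x in `[a n, b n]) (h' x)%:E)); last exact/funext.
apply: L1.
- by move=> m n mn; rewrite /a lef_pV2 ?posrE ?ltr0n// ler_nat ltnS.
- by move=> m n mn; rewrite ler_nat ltnS.
Unshelve. all: by end_near. Qed.

End Inversion.

(** * Radial integrals *)

Section Radial.
Context {R : realType}.
Local Notation mu := (@lebesgue_measure R).
Local Notation area := (mu \x mu)%E.
Local Open Scope ereal_scope.
Implicit Types (f : R -> \bar R) (F : R * R -> \bar R).

Lemma integral_fold f :
  measurable_fun [set: R] f -> (forall x, 0 <= f x) ->
  \int[mu]_x f x = \int[mu]_(x in `]0%R, +oo[) (f x + f (- x)%R).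
Proof.
move=> mf f0.
have mfN : measurable_fun [set: R] (fun x : R => f (- x)%R).
  exact: measurableT_comp.
rewrite ge0_integralD//=; last 2 first.
- exact: measurable_funTS.
- exact: measurable_funTS.
have -> : \int[mu]_(x in `]0%R, +oo[) f (- x)%R = \int[mu]_(x in `]-oo, 0%R[) f x.
  rewrite integral_mkcond [RHS]integral_mkcond.
  rewrite -[RHS](@integral_scale _ (-1)%R) ?oppr_eq0 ?oner_eq0//; last 2 first.
  - by apply/(measurable_restrictT _ _).1 => //; exact: measurable_funTS.
  - by move=> x; rewrite patchE; case: ifP.
  rewrite normrN normr1 mul1e; apply: eq_integral => x _.
  rewrite !patchE mulN1r; congr (if _ then _ else _).
  by apply/idP/idP; rewrite !inE/= !in_itv/= andbT oppr_lt0.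
rewrite addeC [X in _ + X]integral_itv_obnd_cbnd; last exact: measurable_funTS.
rewrite -ge0_integral_setU//=; last 2 first.
- exact: measurable_funTS.
- apply/disj_set2P; apply/seteqP; split => x //= [].
  by rewrite !in_itv/= andbT leNgt => ->.
by rewrite itv_setU_setT.
Qed.

Lemma integral_inv_oneDsqr : \int[mu]_t ((1 + t ^+ 2)^-1)%:E = pi%:E.
Proof.
rewrite integral_fold//=; last 2 first.
- apply/measurable_EFinP; apply: continuous_measurable_fun.
  exact: continuous_oneDsqrV.
- by move=> x; rewrite lee_fin invr_ge0 addr_ge0// sqr_ge0.
rewrite (_ : (fun x : R => _) = (fun x : R => 2%:E * ((1 + x ^+ 2)^-1)%:E)); last first.
  by apply/funext => x; rewrite sqrrN -EFinD -EFinM; congr EFin; ring.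
have mo (A : set R) : measurable_fun A (fun x : R => ((1 + x ^+ 2)^-1)%:E).
  apply: measurable_funTS; apply/measurable_EFinP; apply: continuous_measurable_fun.
  exact: continuous_oneDsqrV.
rewrite ge0_integralZl//=; last 2 first.
- exact: mo.
- by move=> x _; rewrite lee_fin invr_ge0 addr_ge0// sqr_ge0.
rewrite integral_itv_obnd_cbnd; last exact: mo.
rewrite integral0y_oneDsqr -EFinM; congr EFin.
by field.
Qed.

(** On the line of slope t the squared norm is (1 + t^2) x^2, so [Phi] evaluated at it, divided
    by 1 + t^2, is a primitive of 2 x phi; the factor pi is the integral of 1 / (1 + t^2). *)
Lemma area_radial (phi Phi : R -> R) (l : R) :
  (forall s : R, 0 <= s -> 0 <= phi s)%R ->
  (forall s : R, 0 <= s -> {for s, continuous phi})%R ->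
  (forall s : R, 0 <= s -> is_derive s 1%R Phi (phi s))%R ->
  Phi s @[s --> +oo%R] --> l ->
  measurable_fun [set: R] phi ->
  \int[area]_p (phi (p.1 ^+ 2 + p.2 ^+ 2))%:E = (pi * (l - Phi 0))%:E.
Proof.
move=> phi0 cphi dPhi cvPhi mphi.
rewrite area_slope; last 2 first.
- apply/measurable_EFinP; apply: (measurableT_comp mphi).
  by apply: measurable_funD; apply: measurable_funX.
- by move=> p; rewrite lee_fin phi0// addr_ge0// sqr_ge0.
have kp (t : R) : (0 < 1 + t ^+ 2)%R by rewrite ltr_wpDr// sqr_ge0.
have inner (t : R) : \int[mu]_x (`|x|%:E * (phi (x ^+ 2 + (x * t) ^+ 2))%:E) =
    ((1 + t ^+ 2)^-1 * (l - Phi 0))%:E.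
  set k := (1 + t ^+ 2)%R; have k0 : (0 < k)%R := kp t.
  have kx (x : R) : (x ^+ 2 + (x * t) ^+ 2 = k * x ^+ 2)%R by rewrite /k; ring.
  have kx0 (x : R) : (0 <= k * x ^+ 2)%R by rewrite mulr_ge0 ?sqr_ge0 ?ltW.
  have ck (x : R) : {for x, continuous (fun x : R => k * x ^+ 2)%R}.
    apply: continuousM; first exact: cst_continuous.
    exact: exprn_continuous.
  rewrite integral_fold; last 2 first.
  - apply: emeasurable_funM.
      by apply/measurable_EFinP; exact: normr_measurable.
    apply/measurable_EFinP; apply: (measurableT_comp mphi).
    by apply: measurable_funD; apply: measurable_funX => //; apply: measurable_funM.
  - by move=> x; rewrite mule_ge0// lee_fin kx phi0.
  pose h (x : R) := (2 * x * phi (k * x ^+ 2))%R.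
  pose H (x : R) := (k^-1 * Phi (k * x ^+ 2))%R.
  have hx (x : R) : {for x, continuous h}.
    apply: continuousM; first exact: mulrl_continuous.
    apply: (@continuous_comp _ _ _ (fun x : R => k * x ^+ 2)%R phi); first exact: ck.
    by apply: cphi; exact: kx0.
  have ch : continuous h by move=> x; exact: hx.
  have dH (x : R) : is_derive x 1%R H (h x).
    have D1 : is_derive x 1%R (fun x : R => k * x ^+ 2)%R (k * (2 * x))%R.
      apply: is_derive_eq.
      by rewrite /GRing.scale/=; ring.
    have := @is_derive1_comp _ Phi (fun x : R => k * x ^+ 2)%R x _ _ (dPhi _ (kx0 x)) D1.
    move=> D2; have D3 := @is_deriveZ _ _ _ _ (k^-1)%R _ _ _ D2.
    apply: is_derive_eq.
    rewrite /GRing.scale/= /h; field.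
    by rewrite gt_eqF.
  transitivity (\int[mu]_(x in `[0%R, +oo[) (h x)%:E).
    rewrite -integral_itv_obnd_cbnd; last first.
      by apply: measurable_funTS; apply/measurable_EFinP; exact: continuous_measurable_fun.
    apply: eq_integral => x; rewrite inE/= in_itv/= andbT => x0.
    rewrite mulNr sqrrN normrN kx gtr0_norm// -EFinM -EFinD; congr EFin.
    by rewrite /h sqrrN kx; ring.
  rewrite (@ge0_continuous_FTC2y _ h H 0%R (k^-1 * l)%R).
  - by rewrite -EFinB /H expr0n/= mulr0 -mulrBr.
  - by move=> x x0; rewrite /h !mulr_ge0// phi0.
  - exact: continuous_subspaceT.
  - apply: cvgM; first exact: cvg_cst.
    apply: (@cvg_comp _ _ _ (fun x : R => k * x ^+ 2)%R Phi _ (pinfty_nbhs R)) => //.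
    apply: gt0_cvgMry => //.
    apply/cvgryPge => A; near=> x.
    have x1 : (1 <= x)%R by near: x; exact: nbhs_pinfty_ge.
    apply: (@le_trans _ _ x).
      by near: x; apply: nbhs_pinfty_ge; exact: num_real.
    by rewrite expr2 ler_peMr// (le_trans _ x1).
  - by move=> x _; have [] := dH x.
  - apply: cvg_at_right_filter; apply: differentiable_continuous.
    by apply/derivable1_diffP; have [] := dH 0%R.
  - by move=> x _; rewrite derive1E; have /= -> := @derive_val _ _ _ _ _ _ _ (dH x).
under eq_integral do rewrite inner EFinM.
rewrite ge0_integralZr//.
- by rewrite integral_inv_oneDsqr EFinM.
- apply/measurable_EFinP; apply: continuous_measurable_fun.
  exact: continuous_oneDsqrV.
- by move=> t _; rewrite lee_fin invr_ge0 ltW.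
- have : 0 <= ((1 + 0 ^+ 2)^-1 * (l - Phi 0))%:E.
    rewrite -inner; apply: integral_ge0 => x _; rewrite mule_ge0// lee_fin phi0//.
    by rewrite addr_ge0// sqr_ge0.
  by rewrite expr0n/= addr0 invr1 mul1r.
Unshelve. all: by end_near. Qed.

End Radial.

(** * The mean of the logarithm of the chordal distance *)

Section Potential.
Context {R : realType}.
Local Notation mu := (@lebesgue_measure R).
Local Notation area := (mu \x mu)%E.
Local Open Scope ereal_scope.
Implicit Types (F G : R * R -> \bar R).

Definition sqn (p : R * R) : R := (p.1 ^+ 2 + p.2 ^+ 2)%R.

Lemma sqn_ge0 p : (0 <= sqn p)%R.
Proof. by rewrite addr_ge0// sqr_ge0. Qed.

Lemma measurable_sqn : measurable_fun [set: R * R] sqn.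
Proof. by apply: measurable_funD; apply: measurable_funX. Qed.

(** The map z |-> 1 / conj z has Jacobian |z|^(-4) and, in slope coordinates, is
    x |-> 1 / ((1 + t^2) x) on each line.  The hypotheses on [F] and [G] leave out the line
    x = 0, so that both functions may be singular at the origin. *)
Lemma area_inversion F G (g : R * R -> R) :
  measurable_fun [set: R * R] F -> (forall p, 0 <= F p) ->
  measurable_fun [set: R * R] G -> (forall p, 0 <= G p) ->
  (forall p : R * R, p.1 != 0 -> F p = (g p)%:E)%R ->
  (forall t x : R, x != 0 -> {for x, continuous (fun y : R => g (y, y * t))})%R ->
  (forall p : R * R, p.1 != 0 ->
     G p = ((sqn p ^+ 2)^-1 * g (p.1 / sqn p, p.2 / sqn p))%:E)%R ->
  \int[area]_p F p = \int[area]_p G p.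
Proof.
move=> mF F0 mG G0 Fg cg Gg.
have mslope (H : R * R -> \bar R) t : measurable_fun [set: R * R] H ->
    measurable_fun [set: R] (fun x : R => `|x|%:E * H (x, x * t)%R).
  move=> mH; apply: emeasurable_funM.
    by apply/measurable_EFinP; exact: normr_measurable.
  apply: (measurableT_comp mH); apply/measurable_fun_pairP; split.
    exact: measurable_id.
  exact: measurable_funM.
rewrite area_slope// [RHS]area_slope//; apply: eq_integral => t _.
rewrite integral_fold; last 2 first.
- exact: mslope.
- by move=> x; rewrite mule_ge0.
rewrite [RHS]integral_fold; last 2 first.
- exact: mslope.
- by move=> x; rewrite mule_ge0.
pose h (x : R) := (x * (g (x, x * t) + g (- x, - x * t)))%R.
set k := (1 + t ^+ 2)%R.
have k0 : (0 < k)%R by rewrite ltr_wpDr// sqr_ge0.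
have gx (x : R) : (x != 0 -> 0 <= g (x, x * t))%R.
  by move=> x0; rewrite -lee_fin -Fg.
transitivity (\int[mu]_(x in `]0%R, +oo[) (h x)%:E).
  apply: eq_integral => x; rewrite inE/= in_itv/= andbT => x0.
  rewrite normrN gtr0_norm// !Fg/= ?oppr_eq0 ?gt_eqF// -!EFinM -EFinD -mulrDr.
  by [].
rewrite (integral_inversion k0); last 2 first.
- move=> x x0; apply: continuousM; first exact: cvg_id.
  apply: continuousD; first by apply: cg; rewrite gt_eqF.
  apply: (@continuous_comp _ _ _ (fun y : R => - y)%R (fun y => g (y, y * t)%R)).
    exact: opp_continuous.
  by apply: cg; rewrite oppr_eq0 gt_eqF.
- move=> x x0; apply: mulr_ge0; first exact: ltW.
  by apply: addr_ge0; apply: gx; rewrite ?oppr_eq0 gt_eqF.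
apply: eq_integral => x; rewrite inE/= in_itv/= andbT => x0.
have xn0 : (x != 0)%R by rewrite gt_eqF.
rewrite normrN gtr0_norm// !Gg/= ?oppr_eq0// -!EFinM -EFinD; congr EFin.
have -> : (sqn (x, x * t) = k * x ^+ 2)%R by rewrite /sqn/= /k; ring.
have -> : (sqn (- x, - x * t) = k * x ^+ 2)%R by rewrite /sqn/= /k; ring.
have kn0 : (k != 0)%R by rewrite gt_eqF.
have -> : (x / (k * x ^+ 2) = (k * x)^-1)%R by field; rewrite xn0.
have -> : (x * t / (k * x ^+ 2) = (k * x)^-1 * t)%R by field; rewrite xn0.
have -> : (- x / (k * x ^+ 2) = - (k * x)^-1)%R by field; rewrite xn0.
have -> : (- x * t / (k * x ^+ 2) = - (k * x)^-1 * t)%R by field; rewrite xn0.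
by rewrite /h; field; rewrite xn0.
Qed.

Lemma sphere_area :
  \int[area]_p (((1 + sqn p) ^+ 2)^-1)%:E = pi%:E.
Proof.
have pos (s : R) : (0 <= s -> 1 + s != 0)%R by move=> s0; rewrite gt_eqF// ltr_wpDr.
have dP (s : R) : (0 <= s)%R -> is_derive s 1%R (fun s : R => - (1 + s)^-1)%R ((1 + s) ^+ 2)^-1%R.
  move=> s0; have D := @is_deriveV _ (fun s => 1 + s)%R s _ 1%R (pos _ s0) (is_deriveD _ _).
  apply: is_derive_eq; rewrite /GRing.scale/=; field; exact: pos.
rewrite (area_radial (phi := fun s => ((1 + s) ^+ 2)^-1%R) _ _ dP (l := 0%R)).
- by rewrite addr0 invr1 sub0r opprK mulr1.
- by move=> s s0; rewrite invr_ge0 sqr_ge0.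
- move=> s s0; apply: continuousV; first by rewrite expf_neq0// pos.
  apply: (@continuous_comp _ _ _ (fun s : R => 1 + s)%R (fun s : R => s ^+ 2)%R).
    by apply: continuousD; [exact: cst_continuous|exact: cvg_id].
  exact: exprn_continuous.
- rewrite -oppr0; apply: cvgN; apply/gtr0_cvgV0.
    near=> s; rewrite ltr_wpDr//; near: s; apply: nbhs_pinfty_ge; exact: num_real.
  apply/cvgryPge => A; near=> s.
  rewrite -lerBlDl; near: s; apply: nbhs_pinfty_ge; exact: num_real.
- apply: (measurableT_comp measurable_inv); apply: measurable_funX.
  exact: measurable_funD.
Unshelve. all: by end_near. Qed.

(** A primitive of log (1 + s) / (1 + s)^2 is - (1 + log (1 + s)) / (1 + s), which goes from
    -1 to 0. *)
Lemma sphere_log_integral :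
  \int[area]_p (ln (1 + sqn p) / (1 + sqn p) ^+ 2)%:E = pi%:E.
Proof.
have pos0 (s : R) : (0 <= s -> 0 < 1 + s)%R by move=> s0; rewrite ltr_wpDr.
have pos (s : R) : (0 <= s -> 1 + s != 0)%R by move=> s0; rewrite gt_eqF// pos0.
have dP (s : R) : (0 <= s)%R -> is_derive s 1%R
    (fun s : R => - ((1 + ln (1 + s)) * (1 + s)^-1))%R (ln (1 + s) / (1 + s) ^+ 2)%R.
  move=> s0; have D := @is_deriveV _ (fun s => 1 + s)%R s _ 1%R (pos _ s0) (is_deriveD _ _).
  have D1 : is_derive s 1%R (fun s : R => 1 + s)%R 1%R.
    by apply: (is_derive_eq (is_deriveD (is_derive_cst _ _ _) (is_derive_id _ _))); rewrite add0r.
  have D2 := is_derive1_comp (is_derive1_ln (pos0 _ s0)) D1.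
  have D3 : is_derive s 1%R (fun s : R => 1 + ln (1 + s))%R ((1 + s)^-1)%R.
    apply: (is_derive_eq (is_deriveD (is_derive_cst _ _ _) D2)).
    by rewrite add0r /GRing.scale/= ?mulr1 ?mul1r.
  apply: is_derive_eq; rewrite /GRing.scale/=; field; exact: pos.
rewrite (area_radial (phi := (fun s => ln (1 + s) / (1 + s) ^+ 2)%R) _ _ dP (l := 0%R)).
- by rewrite addr0 invr1 ln1 addr0 !mulr1 sub0r opprK mulr1.
- by move=> s s0; rewrite divr_ge0 ?sqr_ge0// ln_ge0// lerDl.
- move=> s s0; apply: continuousM; last first.
    apply: continuousV; first by rewrite expf_neq0// pos.
    apply: (@continuous_comp _ _ _ (fun s : R => 1 + s)%R (fun s : R => s ^+ 2)%R).
      by apply: continuousD; [exact: cst_continuous|exact: cvg_id].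
    exact: exprn_continuous.
  apply: (@continuous_comp _ _ _ (fun s : R => 1 + s)%R (@ln R)).
    by apply: continuousD; [exact: cst_continuous|exact: cvg_id].
  by apply: continuous_ln; exact: pos0.
- rewrite -oppr0; apply: cvgN.
  apply/cvgrPdist_le => e e0; near=> s.
  have s0 : (0 <= s)%R by near: s; apply: nbhs_pinfty_ge; exact: num_real.
  have y0 := pos0 _ s0.
  set r := Num.sqrt (1 + s)%R.
  have r0 : (0 < r)%R by rewrite sqrtr_gt0.
  have r1 : (1 <= r)%R by rewrite -sqrtr1 ler_wsqrtr// lerDl.
  have rE : (1 + s = r ^+ 2)%R by rewrite sqr_sqrtr// ltW.
  have re : (3 / e <= r)%R.
    rewrite -(@ler_pXn2r _ 2)// ?nnegrE ?divr_ge0 ?(ltW e0) ?(ltW r0)// -rE.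
    by rewrite -lerBlDl; near: s; apply: nbhs_pinfty_ge; exact: num_real.
  have := ln_sublinear r0 => lnr.
  rewrite sub0r normrN ger0_norm; last first.
    by rewrite divr_ge0 ?(ltW y0)// addr_ge0// ln_ge0// lerDl.
  rewrite rE lnXn// ler_pdivrMr ?exprn_gt0// expr2 mulrA.
  apply: (@le_trans _ _ (3 * r)%R); first by rewrite mulr2n; lra.
  by rewrite ler_pM2r//; move: re; rewrite ler_pdivrMr// mulrC.
- apply: measurable_funM; last first.
    apply: (measurableT_comp measurable_inv); apply: measurable_funX.
    exact: measurable_funD.
  apply: measurableT_comp; first exact: measurable_ln.
  exact: measurable_funD.
Unshelve. all: by end_near. Qed.

Lemma measurable_lneEFin : measurable_fun [set: R] (fun x : R => lne x%:E).
Proof.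
apply: measurable_fun_ifT; first exact: measurable_fun_ler.
- exact: measurable_cst.
- by apply/measurable_EFinP; exact: measurable_ln.
Qed.

(** Up to a factor, the squared distance of the stereographic projections. *)
Definition chord2 (w p : R * R) : R :=
  (sqn (p.1 - w.1, p.2 - w.2) / ((1 + sqn p) * (1 + sqn w)))%R.

Lemma chord2_ge0 w p : (0 <= chord2 w p)%R.
Proof.
apply: divr_ge0; first exact: sqn_ge0.
by apply: mulr_ge0; rewrite addr_ge0// sqn_ge0. Qed.

(** The defect (1 + |p|^2) (1 + |w|^2) - |p - w|^2 is |1 + p conj w|^2. *)
Lemma chord2_le1 w p : (chord2 w p <= 1)%R.
Proof.
rewrite ler_pdivrMr ?mul1r ?mulr_gt0 ?ltr_wpDr ?sqn_ge0//.
rewrite -subr_ge0 (_ : _ - _ = (1 + p.1 * w.1 + p.2 * w.2) ^+ 2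
  + (p.1 * w.2 - p.2 * w.1) ^+ 2)%R; first by rewrite addr_ge0 ?sqr_ge0.
by rewrite /sqn/=; ring.
Qed.

Lemma measurable_chord2 w : measurable_fun [set: R * R] (chord2 w).
Proof.
apply: measurable_funM.
  apply: measurable_funD; apply: measurable_funX; exact: measurable_funB.
apply: (measurableT_comp measurable_inv); apply: measurable_funM => //.
by apply: measurable_funD => //; exact: measurable_sqn.
Qed.

Lemma measurable_density : measurable_fun [set: R * R] (fun p => ((1 + sqn p) ^+ 2)^-1)%R.
Proof.
apply: (measurableT_comp measurable_inv); apply: measurable_funX.
by apply: measurable_funD => //; exact: measurable_sqn.
Qed.

(** A rotation of the sphere taking w to infinity turns this integral into
    [sphere_log_integral]; the rotation is decomposed into a translation, an inversion,
    a translation and a dilation. *)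
Lemma sphere_log_chord w :
  \int[area]_p (- lne (chord2 w p)%:E * (((1 + sqn p) ^+ 2)^-1)%:E) = pi%:E.
Proof.
set F := fun p => - lne (chord2 w p)%:E * (((1 + sqn p) ^+ 2)^-1)%:E.
have F0 p : 0 <= F p.
  rewrite mule_ge0 ?lee_fin ?invr_ge0 ?sqr_ge0// oppe_ge0 lne_le0 lee_fin.
  exact: chord2_le1.
have mF : measurable_fun [set: R * R] F.
  apply: emeasurable_funM.
    apply: measurableT_comp => //.
    exact: (measurableT_comp measurable_lneEFin (measurable_chord2 w)).
  by apply/measurable_EFinP; exact: measurable_density.
rewrite -(area_translate w.1 w.2)//.
set F1 := fun p : R * R => F (p.1 + w.1, p.2 + w.2)%R.
have mF1 : measurable_fun [set: R * R] F1.
  apply: (measurableT_comp mF); apply/measurable_fun_pairP.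
  by split; apply: measurable_funD.
set q := (1 + sqn w)%R.
have q0 : (0 < q)%R by rewrite ltr_wpDr ?sqn_ge0.
have qn0 : (q != 0)%R by rewrite gt_eqF.
(* Q p = 1 + 2 (w . p) + q |p|^2 is |p|^2 (1 + |w + 1 / conj p|^2); completing the square
   prepares for the translation by w / q. *)
pose Q p := (q * sqn (p.1 + w.1 / q, p.2 + w.2 / q) + q^-1)%R.
have Q0 p : (0 < Q p)%R by rewrite ltr_wpDl ?invr_gt0// mulr_ge0 ?sqn_ge0 ?ltW.
have qQ p : (q * Q p = 1 + (q ^+ 2 * sqn (p.1 + w.1 / q, p.2 + w.2 / q)))%R.
  by rewrite /Q; field.
have qQ1 p : (1 <= q * Q p)%R by rewrite qQ lerDl mulr_ge0 ?sqr_ge0 ?sqn_ge0.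
pose G p := (ln (q * Q p) / Q p ^+ 2)%:E.
have G0 p : 0 <= G p by rewrite lee_fin divr_ge0 ?sqr_ge0// ln_ge0.
have mQ : measurable_fun [set: R * R] Q.
  apply: measurable_funD => //; apply: measurable_funM => //.
  apply: (measurableT_comp measurable_sqn); apply/measurable_fun_pairP.
  by split; apply: measurable_funD.
have mG : measurable_fun [set: R * R] G.
  apply/measurable_EFinP; apply: measurable_funM.
    apply: (measurableT_comp (@measurable_ln R)); exact: measurable_funM.
  apply: (measurableT_comp measurable_inv); exact: measurable_funX.
pose T p := (1 + sqn (p.1 + w.1, p.2 + w.2))%R.
have T0 p : (0 < T p)%R by rewrite ltr_wpDr ?sqn_ge0.
pose g (p : R * R) := (ln (T p * q / sqn p) / T p ^+ 2)%R.
have sqn0 (p : R * R) : (p.1 != 0 -> 0 < sqn p)%R.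
  move=> p0; rewrite /sqn ltr_wpDr ?sqr_ge0//.
  by rewrite lt_neqAle sqr_ge0 andbT eq_sym sqrf_eq0.
transitivity (\int[area]_p G p).
  apply: (@area_inversion F1 G g) => //.
  - by move=> p; exact: F0.
  - move=> p p0; rewrite /F1 /F.
    have -> : chord2 w (p.1 + w.1, p.2 + w.2)%R = (sqn p / (T p * q))%R.
      by rewrite /chord2/= !addrK -surjective_pairing.
    rewrite lne_EFin; last by rewrite divr_gt0 ?mulr_gt0 ?sqn0.
    rewrite -EFinN -EFinM /g -lnV ?posrE; last by rewrite divr_gt0 ?mulr_gt0 ?sqn0.
    by rewrite invf_div.
  - move=> t x x0.
    have cT : {for x, continuous (fun y : R => T (y, y * t))%R}.
      rewrite /T /sqn/=.
      apply: continuousD; first exact: cst_continuous.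
      apply: continuousD.
        apply: (@continuous_comp _ _ _ (fun y : R => y + w.1)%R (fun s : R => s ^+ 2)%R).
          by apply: continuousD; [exact: cvg_id|exact: cst_continuous].
        exact: exprn_continuous.
      apply: (@continuous_comp _ _ _ (fun y : R => y * t + w.2)%R (fun s : R => s ^+ 2)%R).
        by apply: continuousD; [exact: mulrr_continuous|exact: cst_continuous].
      exact: exprn_continuous.
    have cS : {for x, continuous (fun y : R => sqn (y, y * t))%R}.
      rewrite /sqn/=; apply: continuousD; first exact: exprn_continuous.
      apply: (@continuous_comp _ _ _ (fun y : R => y * t)%R (fun s : R => s ^+ 2)%R).
        exact: mulrr_continuous.
      exact: exprn_continuous.
    have S0 : (0 < sqn (x, x * t))%R by exact: sqn0.
    rewrite /g; apply: continuousM.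
      apply: (@continuous_comp _ _ _ (fun y : R => T (y, y * t) * q / sqn (y, y * t))%R (@ln R)).
        apply: continuousM; first by apply: continuousM; [exact: cT|exact: cst_continuous].
        by apply: continuousV; [rewrite gt_eqF|exact: cS].
      by apply: continuous_ln; rewrite divr_gt0 ?mulr_gt0.
    apply: continuousV; first by rewrite expf_neq0// gt_eqF.
    apply: (@continuous_comp _ _ _ (fun y : R => T (y, y * t))%R (fun s : R => s ^+ 2)%R) => //.
    exact: exprn_continuous.
  - move=> p p0; rewrite /G /g; have n0 := sqn0 _ p0.
    have nn0 : (sqn p != 0)%R by rewrite gt_eqF.
    have -> : (sqn (p.1 / sqn p, p.2 / sqn p) = (sqn p)^-1)%R.
      rewrite {1}/sqn/= !expr_div_n -mulrDl -/(sqn p) expr2; field.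
      exact: nn0.
    have -> : (T (p.1 / sqn p, p.2 / sqn p) = Q p / sqn p)%R.
      move: nn0 qn0; rewrite /T /Q /q /sqn/= => n1 n2.
      by field; rewrite n1 n2.
    congr EFin; rewrite (_ : Q p / sqn p * q / (sqn p)^-1 = q * Q p)%R; last by field.
    by field; rewrite nn0 gt_eqF.
rewrite -(area_translate (- (w.1 / q)) (- (w.2 / q)))//.
pose G1 := fun p : R * R => G (p.1 - w.1 / q, p.2 - w.2 / q)%R.
have mG1 : measurable_fun [set: R * R] G1.
  apply: (measurableT_comp mG); apply/measurable_fun_pairP.
  by split; apply: measurable_funD.
have qi0 : (q^-1 != 0)%R by rewrite invr_eq0.
rewrite -(area_scale qi0 mG1); last by move=> p; exact: G0.
rewrite -sphere_log_integral -ge0_integralZl//.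
- apply: eq_integral => p _; rewrite /G1 /G qQ /Q/= !subrK -EFinM; congr EFin.
  have -> : (sqn (q^-1 * p.1, q^-1 * p.2) = sqn p / q ^+ 2)%R.
    by rewrite /sqn/=; field.
  have -> : (q ^+ 2 * (sqn p / q ^+ 2) = sqn p)%R by field.
  have : (1 + sqn p != 0)%R by rewrite gt_eqF// ltr_wpDr ?sqn_ge0.
  move=> h; field. by rewrite h.
- apply: (measurableT_comp mG1); apply/measurable_fun_pairP.
  by split; apply: measurable_funM.
- by move=> p _; exact: G0.
- by rewrite lee_fin sqr_ge0.
Qed.

End Potential.

(** * From chordal distances to the packing number *)

Section Packing.
Context {R : realType}.
Local Notation mu := (@lebesgue_measure R).
Local Notation area := (mu \x mu)%E.
Local Open Scope ereal_scope.

Definition plane (z : R[i]) : R * R := (complex.Re z, complex.Im z).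

Lemma normc_sqn (z : R[i]) : (normc z ^+ 2 = sqn (plane z))%R.
Proof. by case: z => x y; rewrite /normc sqr_sqrtr// addr_ge0 ?sqr_ge0. Qed.

Lemma US_chord2 (z w : R[i]) :
  US z w = (2^-1)%R%:E + (2^-1)%R%:E * lne (chord2 (plane w) (plane z))%:E.
Proof.
rewrite /US /chord2 !normc_sqn; congr (_ + _ * lne (_ / _)%:E).
by case: z => x y; case: w => u v.
Qed.

Lemma integral_dASE (F : R[i] -> \bar R) :
  integral_dAS F = \int[area]_p (F (p.1 +i* p.2)%C * (((1 + sqn p) ^+ 2)^-1)%:E).
Proof.
by apply: eq_integral => -[x y] _; rewrite normc_sqn.
Qed.

(** The convention 0 `^ (beta / 2) = 0 matches the value -oo of [US] on the diagonal, so both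
    sides agree at every point. *)
Lemma expeR_US (beta : R) z w : (0 < beta)%R ->
  expeR (beta%:E * US z w) =
    ((expR 1 * chord2 (plane w) (plane z)) `^ (beta / 2))%:E.
Proof.
move=> b0; rewrite US_chord2; have := chord2_ge0 (plane w) (plane z).
rewrite le_eqVlt => /predU1P[<-|d0].
  rewrite mulr0 powR0 ?gt_eqF ?divr_gt0// le0_lneNy//.
  rewrite gt0_muleNy ?lte_fin ?invr_gt0// addeNy gt0_muleNy ?lte_fin//.
rewrite lne_EFin// /=; congr EFin.
rewrite /powR gt_eqF; last by apply: mulr_gt0; [exact: expR_gt0|].
congr expR.
by rewrite lnM ?posrE ?expR_gt0// expRK; field.
Qed.

Lemma expeR_sum_US (N : nat) (beta : R) z (w : 'I_N -> R[i]) : (0 < beta)%R ->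
  expeR (\sum_(i < N) beta%:E * US z (w i)) =
    (\prod_(i < N) ((expR 1 * chord2 (plane (w i)) (plane z)) `^ (beta / 2)))%:E.
Proof.
move=> b0; elim/big_ind2 : _ => [|x a y b xa yb|i _]; first exact: expeR0.
- by rewrite expeRD xa yb.
- exact: expeR_US.
Qed.

Lemma measurable_chord_power (w : R * R) (b : R) :
  measurable_fun [set: R * R] (fun p => (expR 1 * chord2 w p) `^ b)%R.
Proof.
apply: (measurableT_comp (measurable_powR b)).
by apply: measurable_funM => //; exact: measurable_chord2.
Qed.

(** Where f is the exponent, exp f >= 1 + f, and the terms of - f that involve log d are
    nonnegative with known integral; moving them to the left keeps all integrands nonnegative,
    and no integrability of f is required. *)
Lemma packing_lb (N : nat) (beta : R) : (0 < beta)%R -> 1 <= packing_number N beta.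
Proof.
move=> b0; apply: le_ereal_inf_tmp => _ [w _ <-].
pose d i p := chord2 (plane (w i)) p.
pose X (p : R * R) := (\prod_(i < N) ((expR 1 * d i p) `^ (beta / 2)))%R.
pose dens (p : R * R) := (((1 + sqn p) ^+ 2)^-1)%R.
pose L i p := - lne (d i p)%:E.
have dens0 p : (0 <= dens p)%R by rewrite invr_ge0 sqr_ge0.
have X0 p : (0 <= X p)%R by rewrite prodr_ge0// => i _; exact: powR_ge0.
have L0 i p : 0 <= L i p by rewrite oppe_ge0 lne_le0 lee_fin chord2_le1.
have mdens := @measurable_density R.
have mX : measurable_fun [set: R * R] X.
  by apply: measurable_prod => i _; exact: measurable_chord_power.
have mL i : measurable_fun [set: R * R] (L i).
  apply: measurableT_comp => //.
  exact: (measurableT_comp measurable_lneEFin (measurable_chord2 _)).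
set I := integral_dAS _.
have IE : I = \int[area]_p (X p * dens p)%:E.
  rewrite /I integral_dASE; apply: eq_integral => -[x y] _.
  by rewrite expeR_sum_US.
have bN0 : (0 <= beta / 2)%R by rewrite divr_ge0// ltW.
pose Y i p := (beta / 2)%:E * (L i p * (dens p)%:E).
have Y0 i p : 0 <= Y i p by rewrite !mule_ge0 ?lee_fin.
have mY i : measurable_fun [set: R * R] (Y i).
  apply: measurable_funeM; apply: emeasurable_funM => //.
  exact/measurable_EFinP.
have pt p : ((1 + N%:R * (beta / 2)) * dens p)%:E <=
    (X p * dens p)%:E + \sum_(i < N) Y i p.
  (* At a point w_i the integrand vanishes, but the logarithm of d is infinite. *)
  have [[i di]|nd] := pselect (exists i, d i p <= 0)%R.
    rewrite [leRHS](_ : _ = +oo) ?leey//.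
    rewrite (bigD1 i)//= {1}/Y {1}/L le0_lneNy ?lee_fin//=.
    have dp : (0 < dens p)%R by rewrite invr_gt0 exprn_gt0// ltr_wpDr ?sqn_ge0.
    rewrite mulyr gtr0_sg// mul1e mulry gtr0_sg ?divr_gt0// mul1e.
    rewrite addye; first by rewrite addey.
    by rewrite gt_eqF// (@lt_le_trans _ _ 0)// sume_ge0.
  have d0 i : (0 < d i p)%R by rewrite ltNge; apply/negP => di; apply: nd; exists i.
  have -> : \sum_(i < N) Y i p = (\sum_(i < N) (beta / 2 * (- ln (d i p) * dens p)))%:E.
    by rewrite -sumEFin; apply: eq_bigr => i _; rewrite /Y /L lne_EFin.
  have -> : X p = expR (\sum_(i < N) (beta / 2 * (1 + ln (d i p)))).
    rewrite expR_sum; apply: eq_bigr => i _.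
    rewrite /powR gt_eqF; last by apply: mulr_gt0; [exact: expR_gt0|].
    congr expR.
    by rewrite lnM ?posrE ?expR_gt0// expRK.
  rewrite -EFinD lee_fin.
  have -> : (\sum_(i < N) (beta / 2 * (- ln (d i p) * dens p)) =
     (\sum_(i < N) (beta / 2 * - ln (d i p))) * dens p)%R.
    by rewrite mulr_suml; apply: eq_bigr => i _; rewrite mulrA.
  rewrite -mulrDl ler_wpM2r//.
  apply: le_trans (lerD (expR_ge1Dx _) (lexx _)).
  rewrite -addrA -big_split/= lerD2l.
  rewrite (eq_bigr (fun=> beta / 2)%R); last by move=> i _; ring.
  by rewrite sumr_const card_ord mulr_natl.
have mXd : measurable_fun [set: R * R] (fun p => (X p * dens p)%:E).
  by apply/measurable_EFinP; exact: measurable_funM.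
have mS : measurable_fun [set: R * R] (fun p => \sum_(i < N) Y i p).
  exact: emeasurable_sum.
have : \int[area]_p ((1 + N%:R * (beta / 2)) * dens p)%:E <=
    \int[area]_p ((X p * dens p)%:E + \sum_(i < N) Y i p).
  apply: ge0_le_integral => //.
  - by move=> p _; rewrite lee_fin mulr_ge0// addr_ge0// mulr_ge0.
  - by apply/measurable_EFinP; exact: measurable_funM.
  - exact: emeasurable_funD.
under eq_integral do rewrite EFinM.
rewrite ge0_integralZl//; last 3 first.
- exact/measurable_EFinP.
- by move=> p _; rewrite lee_fin.
- by rewrite lee_fin addr_ge0// mulr_ge0.
rewrite sphere_area ge0_integralD//; last 2 first.
- by move=> p _; rewrite lee_fin mulr_ge0.
- by move=> p _; rewrite sume_ge0.
rewrite ge0_integral_sum//= -IE.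
rewrite (eq_bigr (fun=> (beta / 2 * pi)%:E)); last first.
  move=> i _; rewrite ge0_integralZl_EFin//.
  - by rewrite sphere_log_chord.
  - by move=> p _; rewrite mule_ge0// lee_fin.
  - by apply: emeasurable_funM; [exact: mL|exact/measurable_EFinP].
rewrite sumEFin sumr_const card_ord -EFinM.
have pi0 := @pi_gt0 R.
have : -oo < I by rewrite IE (@lt_le_trans _ _ 0)// integral_ge0// => p _; rewrite lee_fin mulr_ge0.
case: I {IE} => [r _|_ _|//]; last by rewrite gt0_muley ?leey// lte_fin invr_gt0.
rewrite -EFinD -EFinM !lee_fin -mulr_natl => le.
rewrite ler_pdivlMl// mulr1; lra.
Qed.

Lemma packing_zero (N : nat) : packing_number N (0 : R) = 1.
Proof.
rewrite /packing_number (_ : [set _ | _ in _] = [set 1]) ?ereal_inf1//.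
have E (w : 'I_N -> R[i]) : (pi^-1)%:E *
    integral_dAS (fun z : R[i] => expeR (\sum_(i < N) 0%:E * US z (w i))) = 1.
  have expU z : expeR (\sum_(i < N) 0%:E * US z (w i)) = 1.
    by rewrite big1 ?expeR0// => i _; rewrite mul0e.
  rewrite integral_dASE.
  under eq_integral do rewrite expU mul1e.
  by rewrite sphere_area -EFinM mulVf// gt_eqF// pi_gt0.
apply/seteqP; split => [_ [w _ <-]|_ ->]; first exact: E.
by exists (fun=> 0%R) => //; exact: E.
Qed.

Lemma powR_prod (N : nat) (f : 'I_N -> R) (b : R) : (forall i, 0 <= f i)%R ->
  (\prod_(i < N) (f i `^ b) = (\prod_(i < N) f i) `^ b)%R.
Proof.
move=> f0; suff [] : (\prod_(i < N) (f i `^ b) = (\prod_(i < N) f i) `^ b /\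
  0 <= \prod_(i < N) f i)%R by [].
apply: (big_rec2 (fun x y => x = y `^ b /\ 0 <= y)%R); first by rewrite powR1.
by move=> i x y _ [-> y0]; split; [rewrite powRM|exact: mulr_ge0].
Qed.

(** A bound on the product of the e d(z, w_i) that is uniform in z bounds the integrand by
    the constant K^beta, and the sphere has area pi. *)
Lemma packing_ub (N : nat) (beta K : R) (w : 'I_N -> R[i]) : (0 < beta)%R ->
  (0 <= K)%R ->
  (forall z, \prod_(i < N) (expR 1 * chord2 (plane (w i)) (plane z)) <= K ^+ 2)%R ->
  packing_number N beta <= (K `^ beta)%:E.
Proof.
move=> b0 K0 bound.
set I := integral_dAS (fun z => expeR (\sum_(i < N) beta%:E * US z (w i))).
apply: (@le_trans _ _ ((pi^-1)%:E * I)); first by apply: ereal_inf_lbound; exists w.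
have mdens := @measurable_density R.
suff : I <= (K `^ beta * pi)%:E.
  have pi0 := @pi_gt0 R.
  move=> IK; apply: (@le_trans _ _ ((pi^-1)%:E * (K `^ beta * pi)%:E)).
    by rewrite lee_pmul2l// ?lte_fin ?invr_gt0.
  by rewrite -EFinM mulrC mulfK// gt_eqF.
rewrite /I integral_dASE EFinM -sphere_area -ge0_integralZl_EFin//; last 3 first.
- by move=> p _; rewrite lee_fin invr_ge0 sqr_ge0.
- exact/measurable_EFinP.
- exact: powR_ge0.
apply: ge0_le_integral => //.
- by move=> p _; rewrite mule_ge0 ?expeR_ge0// lee_fin invr_ge0 sqr_ge0.
- apply: emeasurable_funM; last exact/measurable_EFinP.
  under eq_fun do rewrite expeR_sum_US//.
  apply/measurable_EFinP; apply: measurable_prod => i _.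
  exact: measurable_chord_power.
- by apply: emeasurable_funM => //; exact/measurable_EFinP.
- move=> p _; rewrite expeR_sum_US// -!EFinM lee_fin ler_wpM2r ?invr_ge0 ?sqr_ge0//.
  rewrite powR_prod; last first.
    by move=> i; apply: mulr_ge0; [exact: expR_ge0|exact: chord2_ge0].
  have -> : (K `^ beta = (K ^+ 2) `^ (beta / 2))%R.
    by rewrite -powR_mulrn// -powRrM; congr powR; field.
  apply: ge0_ler_powR; rewrite ?nnegrE ?divr_ge0 ?sqr_ge0 ?(ltW b0)//.
  apply: prodr_ge0 => i _.
  by apply: mulr_ge0; [exact: expR_ge0|exact: chord2_ge0].
Qed.

End Packing.

(** * Elementary inequalities *)

Section LogInequalities.
Context {R : realType}.
Implicit Types a b t x y : R.

Lemma ln_le_subr1 x : 0 < x -> ln x <= x - 1.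
Proof.
move=> x0; have := @le_ln1Dx R (x - 1).
by rewrite addrCA subrr addr0; apply; rewrite ltrBrDl subrr.
Qed.

(** Both sides vanish at 1, and the difference of the derivatives is
    (y - 1)^2 / (y (y + 1)^2). *)
Lemma ln_ge_trapezoid y : 1 <= y -> 2 * (y - 1) / (y + 1) <= ln y.
Proof.
move=> y1.
pose f x : R := ln x + 4 / (x + 1).
have dfx x : 0 < x -> is_derive x 1 f (x^-1 - 4 / (x + 1) ^+ 2).
  move=> x0; have x10 : x + 1 != 0 by rewrite gt_eqF// addr_gt0.
  have D1 := is_derive1_ln x0.
  have D2 : is_derive x 1 (fun x : R => x + 1) 1.
    by apply: (is_derive_eq (is_deriveD (is_derive_id _ _) (is_derive_cst _ _ _))); rewrite addr0.
  have D3 := @is_deriveV _ (fun x : R => x + 1) x _ 1 x10 D2.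
  have D4 := is_deriveZ 4 D3.
  apply: (is_derive_eq (is_deriveD D1 D4)).
  by rewrite /GRing.scale/= mulr1 mulrN.
have : f 1 <= f y.
  apply: (@ger0_derive1_ndecry _ f 1) => //.
  - by move=> x; rewrite in_itv/= andbT => x1; have [] := dfx x (lt_trans ltr01 x1).
  - move=> x; rewrite in_itv/= andbT => x1; have x0 := lt_trans ltr01 x1.
    rewrite derive1E; have /= -> := @derive_val _ _ _ _ _ _ _ (dfx x x0).
    rewrite (_ : _ - _ = (x - 1) ^+ 2 / (x * (x + 1) ^+ 2)).
      by rewrite divr_ge0 ?sqr_ge0// mulr_ge0 ?sqr_ge0 ?ltW.
    by field; rewrite !gt_eqF// addr_gt0.
  - apply: continuous_in_subspaceT => x; rewrite inE/= in_itv/= andbT => x1.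
    apply: differentiable_continuous; apply/derivable1_diffP.
    by have [] := dfx x (lt_le_trans ltr01 x1).
rewrite /f ln1 add0r => h.
have y10 : y + 1 != 0 by rewrite gt_eqF// addr_gt0// (lt_le_trans ltr01).
have -> : 2 * (y - 1) / (y + 1) = 4 / (1 + 1) - 4 / (y + 1) by field.
by rewrite lerBlDr.
Qed.

(** A primitive of ln. *)
Definition lnint x : R := x * ln x - x.

(** The mean of a concave function over an interval is at least the mean of its values at the
    ends. *)
Lemma lnint_trapezoid a b : 0 < a -> a <= b ->
  (b - a) * (ln a + ln b) / 2 <= lnint b - lnint a.
Proof.
move=> a0 ab; have b0 := lt_le_trans a0 ab.
have := @ln_ge_trapezoid (b / a); rewrite ler_pdivlMr// mul1r => /(_ ab).
rewrite ln_div ?posrE//.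
have -> : 2 * (b / a - 1) / (b / a + 1) = 2 * (b - a) / (a + b).
  by field; rewrite !gt_eqF// addr_gt0.
rewrite ler_pdivrMr ?addr_gt0// /lnint => h.
have : 0 <= (ln b - ln a) * (a + b) - 2 * (b - a) by rewrite subr_ge0.
by move=> h2; nra.
Qed.

(** [lnint] is convex, hence above its tangent at [a]. *)
Lemma lnint_tangent a b : 0 < a -> 0 < b -> (b - a) * ln a <= lnint b - lnint a.
Proof.
move=> a0 b0; have := @ln_le_subr1 (a / b) (divr_gt0 a0 b0).
rewrite ln_div ?posrE// -(ler_pM2l b0).
have -> : b * (a / b - 1) = a - b by field; rewrite gt_eqF.
by rewrite /lnint => h; nra.
Qed.

Lemma ln2_ge : 2^-1 <= ln 2 :> R.
Proof.
have := @ln_le_subr1 2^-1; rewrite lnV ?posrE// invr_gt0 => /(_ (ltr0Sn _ _)).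
by lra.
Qed.

Lemma expRN_half j x : j%:R / 2 <= x -> expR (- x) <= (2 / 3) ^+ j :> R.
Proof.
move=> jx; apply: (@le_trans _ _ (expR (- 2^-1) ^+ j)).
  by rewrite -expRM_natl ler_expR mulrN lerNl opprK.
rewrite lerXn2r ?nnegrE ?expR_ge0 ?divr_ge0//.
rewrite expRN -[leRHS]invrK lef_pV2 ?posrE ?expR_gt0 ?invr_gt0 ?divr_gt0//.
by apply: le_trans (expR_ge1Dx _); lra.
Qed.

Lemma geometric_le3 n : \sum_(0 <= j < n) (2 / 3 : R) ^+ j <= 3.
Proof.
suff -> : \sum_(0 <= j < n) (2 / 3 : R) ^+ j = 3 - 3 * (2 / 3) ^+ n.
  by rewrite gerBl mulr_ge0// exprn_ge0// divr_ge0.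
elim: n => [|n IH]; first by rewrite big_nil expr0; ring.
by rewrite big_nat_recr//= IH exprS; field.
Qed.

Lemma sum_odd k : \sum_(0 <= i < k) (2 * i%:R + 1) = k%:R ^+ 2 :> R.
Proof.
elim: k => [|k IH]; first by rewrite big_nil expr0n.
by rewrite big_nat_recr//= IH -natr1; ring.
Qed.

Lemma prod_le_expR (k m : nat) (f u : nat -> R) :
  (forall i, (k <= i < m)%N -> 0 <= f i <= expR (u i)) ->
  0 <= \prod_(k <= i < m) f i <= expR (\sum_(k <= i < m) u i).
Proof.
move=> fu; rewrite expR_sum; apply/andP; split.
  by rewrite big_nat_cond prodr_ge0// => i /andP[/fu/andP[]].
rewrite big_nat_cond [leRHS]big_nat_cond.
by apply: ler_prod => i /andP[/fu].
Qed.

End LogInequalities.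

(** * Rings of points on parallels *)

Section Parallels.
Context {R : realType}.
Implicit Types a b q t x y : R.

(** The largest value, over the points at height [t], of the product of the squared chordal
    distances to [r] equally spaced points at height [tau].  With u and v the modulus of the
    point and the radius of the polygon, it is (u^r + v^r)^2 divided by
    ((1 + u^2) (1 + v^2))^r, attained midway between two vertices. *)
Definition parallel (r : nat) (tau t : R) : R :=
  (Num.sqrt (t * (1 - tau)) ^+ r + Num.sqrt (tau * (1 - t)) ^+ r) ^+ 2.

(** Exchanging the poles is an isometry. *)
Lemma parallel_sym r tau t : parallel r (1 - tau) (1 - t) = parallel r tau t.
Proof.
rewrite /parallel (_ : 1 - (1 - tau) = tau); last by ring.
rewrite (_ : 1 - (1 - t) = t); last by ring.
by rewrite addrC (mulrC (1 - tau)) (mulrC (1 - t)).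
Qed.

Lemma parallel_ge0 r tau t : 0 <= parallel r tau t.
Proof. exact: sqr_ge0. Qed.

(** With x the square root of a / b, the left side is b^r (1 + x^r)^2 <= b^r exp (2 x^r), and
    x^2 <= q <= exp (q - 1). *)
Lemma add_pow_sqrt_le (r : nat) a b q : 0 <= a -> 0 <= b -> a <= q * b ->
  (Num.sqrt a ^+ r + Num.sqrt b ^+ r) ^+ 2 <=
  b ^+ r * expR (2 * expR (- (r%:R / 2 * (1 - q)))).
Proof.
move=> a0 b0 aqb.
set e := expR (- (r%:R / 2 * (1 - q))).
have e0 : 0 <= e by exact: expR_ge0.
have sa : Num.sqrt a <= expR (- ((1 - q) / 2)) * Num.sqrt b.
  rewrite -(@ler_pXn2r _ 2)// ?nnegrE ?mulr_ge0 ?sqrtr_ge0 ?expR_ge0//.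
  rewrite sqr_sqrtr// exprMn sqr_sqrtr// -expRM_natl.
  apply: le_trans aqb _; rewrite ler_wpM2r//.
  have qe : q <= expR (q - 1) by have := expR_ge1Dx (q - 1); rewrite addrC subrK.
  by apply: (le_trans qe); rewrite ler_expR; lra.
have sar : Num.sqrt a ^+ r <= e * Num.sqrt b ^+ r.
  have -> : e = expR (- ((1 - q) / 2)) ^+ r.
    by rewrite -expRM_natl /e; congr expR; ring.
  by rewrite -exprMn lerXn2r ?nnegrE ?mulr_ge0 ?sqrtr_ge0 ?expR_ge0.
have -> : b ^+ r = (Num.sqrt b ^+ r) ^+ 2 by rewrite -exprM mulnC exprM sqr_sqrtr.
have -> : expR (2 * e) = (expR e) ^+ 2 by rewrite -expRM_natl.
rewrite -exprMn lerXn2r ?nnegrE ?addr_ge0 ?mulr_ge0 ?exprn_ge0 ?sqrtr_ge0 ?expR_ge0//.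
apply: (@le_trans _ _ (Num.sqrt b ^+ r * (1 + e))).
  by rewrite mulrDr mulr1 addrC lerD2l mulrC.
by rewrite ler_wpM2l ?exprn_ge0 ?sqrtr_ge0// expR_ge1Dx.
Qed.

(** N times the height of the i-th ring: the geometric mean of i^2 and (i + 1)^2, except at
    the pole, where that mean is 0 and would put the mirror image of the point at infinity.
    The value 1 / 4 serves there because log (1 / 4) <= -1, the mean of log over [0, 1]. *)
Definition scaled_height (i : nat) : R := if i is 0%N then 4^-1 else i%:R * (i%:R + 1).

Lemma scaled_height_gt0 i : 0 < scaled_height i.
Proof. by case: i => [|i] /=; [rewrite invr_gt0|rewrite mulr_gt0// addr_gt0]. Qed.

Lemma scaled_height_le i : scaled_height i <= i%:R * (i%:R + 1) + 4^-1.
Proof. by case: i => [|i] /=; [rewrite mul0r add0r|rewrite lerDl]. Qed.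

Lemma scaled_height_homo i j : (i <= j)%N -> scaled_height i <= scaled_height j.
Proof.
case: i j => [|i] [|j]//= ij.
  have : 1 <= j.+1%:R :> R by rewrite ler1n.
  by nra.
have : i.+1%:R <= j.+1%:R :> R by rewrite ler_nat.
have : 1 <= i.+1%:R :> R by rewrite ler1n.
nra.
Qed.

Lemma scaled_height_le_sqr i : scaled_height i <= i.+1%:R ^+ 2.
Proof.
apply: le_trans (scaled_height_le i) _; rewrite -[i.+1%:R]natr1; have i0 : 0 <= i%:R :> R by [].
by nra.
Qed.

(** A bound for x^r, where x is the ratio of the radii of two parallels and q bounds x^2. *)
Definition overlap (r : nat) q : R := expR (- (r%:R / 2 * (1 - q))).

(** The exponent is at least i (l - i) / l, which is at least half of one of i and l - i. *)
Lemma overlap_below i l : (i <= l)%N ->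
  overlap (2 * i + 1) (scaled_height i / scaled_height l) <= (2 / 3) ^+ i + (2 / 3) ^+ (l - i).
Proof.
move=> il; have l0 := scaled_height_gt0 l.
have q1 : scaled_height i / scaled_height l <= 1 by rewrite ler_pdivrMr// mul1r scaled_height_homo.
have p0 n : 0 <= (2 / 3 : R) ^+ n by rewrite exprn_ge0// divr_ge0.
have [i0|i0] := posnP i.
  rewrite i0 expr0 (@le_trans _ _ 1)//; last by rewrite lerDl.
  rewrite -expR0 ler_expR oppr_le0 mulr_ge0// ?divr_ge0// subr_ge0 -i0//.
case: i i0 il q1 => // i _; case: l l0 => // l l0 il q1.
rewrite /overlap; set X := _ / 2 * _.
have XE : X = (i.+1%:R + 2^-1) * ((l.+1%:R - i.+1%:R) * (l.+1%:R + i.+1%:R + 1) / (l.+1%:R * (l.+1%:R + 1))).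
  rewrite /X /= natrD natrM; field.
  by rewrite !gt_eqF// addr_gt0.
have lr : i.+1%:R <= l.+1%:R :> R by rewrite ler_nat.
have i1 : 1 <= i.+1%:R :> R by rewrite ler1n.
have XL : i.+1%:R * (l.+1%:R - i.+1%:R) / l.+1%:R <= X.
  rewrite XE -subr_ge0; set x := i.+1%:R in lr i1 *; set y := l.+1%:R in lr *.
  have -> : (x + 2^-1) * ((y - x) * (y + x + 1) / (y * (y + 1))) - x * (y - x) / y =
      (y - x) * (x ^+ 2 + (x + y + 1) / 2) / (y * (y + 1)).
    by field; rewrite !gt_eqF//; lra.
  apply: divr_ge0; last by apply: mulr_ge0; lra.
  by apply: mulr_ge0; [lra|apply: addr_ge0; [exact: sqr_ge0|lra]].
have [h|h] := leqP l.+1 (2 * i.+1).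
  apply: (@le_trans _ _ ((2 / 3) ^+ (l.+1 - i.+1))); last by rewrite lerDr.
  apply: expRN_half; apply: le_trans XL; rewrite natrB//.
  have h' : l.+1%:R <= 2 * i.+1%:R :> R by rewrite -natrM ler_nat.
  rewrite ler_pdivlMr; last by lra.
  by nra.
apply: (@le_trans _ _ ((2 / 3) ^+ i.+1)); last by rewrite lerDl.
apply: expRN_half; apply: le_trans XL.
have h' : 2 * i.+1%:R <= l.+1%:R :> R by rewrite -natrM ler_nat ltnW.
rewrite ler_pdivlMr; last by lra.
by nra.
Qed.

(** The exponent is at least (i - k) / 2; indeed it is about i - k. *)
Lemma overlap_above i k : (k <= i)%N ->
  overlap (2 * i + 1) (scaled_height k / scaled_height i) <= (2 / 3) ^+ (i - k).
Proof.
move=> ki; apply: expRN_half; rewrite natrB//.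
have [->|ik] := eqVneq k i.
  by rewrite subrr mul0r divff ?gt_eqF ?scaled_height_gt0// subrr mulr0.
have {ki ik} ki : (k < i)%N by rewrite ltn_neqAle ik.
have kr : k%:R + 1 <= i%:R :> R by rewrite natr1 ler_nat.
have k0 : 0 <= k%:R :> R by [].
have lk := scaled_height_le k.
have liE : scaled_height i = i%:R * (i%:R + 1) by case: i ki {kr}.
have li0 : 0 < scaled_height i := scaled_height_gt0 i.
rewrite natrD natrM.
have -> : 1 - scaled_height k / scaled_height i = (scaled_height i - scaled_height k) / scaled_height i.
  by rewrite mulrBl divff// gt_eqF.
rewrite mulrA ler_pdivlMr// liE.
set x := i%:R in kr *; set y := k%:R in kr k0 lk *.
have h : x * (x + 1) - (y * (y + 1) + 4^-1) <= x * (x + 1) - scaled_height k by lra.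
apply: (@le_trans _ _ ((2 * x + 1) / 2 * (x * (x + 1) - (y * (y + 1) + 4^-1)))); last first.
  by rewrite ler_wpM2l//; lra.
rewrite -subr_ge0.
have -> : (2 * x + 1) / 2 * (x * (x + 1) - (y * (y + 1) + 4^-1)) - (x - y) / 2 * (x * (x + 1)) =
    (x - y) * ((x + 2^-1) * (x + 3 / 4) - 2^-1 * (x * (x + 1)))
    + (x + 2^-1) * ((x - y) * y + (x - y - 1) / 4) by field.
have xy : 0 <= x - y by lra.
have x0 : 0 <= x by lra.
apply: addr_ge0; apply: mulr_ge0 => //; [nra|lra|].
by apply: addr_ge0; [exact: mulr_ge0|lra].
Qed.

End Parallels.

(** * A ring configuration with bounded potential *)

Section Flatness.
Context {R : realType}.
Implicit Types a b q t x y : R.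

Lemma threshold (f : nat -> R) (m : nat) t :
  {homo f : i j / (i <= j)%N >-> i <= j} ->
  exists2 k, (k <= m)%N &
    (forall i, (i < k)%N -> f i <= t) /\ (forall i, (k <= i < m)%N -> t <= f i).
Proof.
move=> fh; elim: m => [|m [k km [below above]]].
  by exists 0%N => //; split => i //; rewrite ltn0 andbF.
have [fm|fm] := leP (f m) t.
  exists m.+1 => //; split => [i|i /andP[mi im]]; last by rewrite ltnNge mi in im.
  by rewrite ltnS => /fh /le_trans; apply.
exists k; first exact: leqW.
split => // i /andP[ki]; rewrite ltnS leq_eqVlt => /predU1P[->|im].
  exact: ltW.
by apply: above; rewrite ki.
Qed.

(** The tangent to log at [y], exponentiated; this form also covers x = 0. *)
Lemma le_expR_ln x y : 0 < y -> x <= expR (ln y + x / y - 1).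
Proof.
move=> y0; rewrite -addrA expRD lnK//.
apply: (@le_trans _ _ (y * (x / y))); first by rewrite mulrC divfK// gt_eqF.
rewrite ler_pM2l//; have := expR_ge1Dx (x / y - 1).
by rewrite (addrC 1) subrK.
Qed.

Lemma add_pow_sqrt_expR (r : nat) a b q v o : 0 <= a -> 0 <= b -> a <= q * b ->
  b <= expR v -> overlap r q <= o ->
  (Num.sqrt a ^+ r + Num.sqrt b ^+ r) ^+ 2 <= expR (r%:R * v + 2 * o).
Proof.
move=> a0 b0 aqb bv ro; apply: le_trans (add_pow_sqrt_le _ a0 b0 aqb) _.
rewrite expRD ler_pM ?exprn_ge0 ?expR_ge0//.
  by rewrite expRM_natl lerXn2r ?nnegrE ?expR_ge0.
by rewrite ler_expR ler_pM2l.
Qed.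

Context (m r : nat) (r_le : (r <= 4 * m + 1)%N) (mr_gt0 : (0 < 2 * m ^ 2 + r)%N).
Let n : R := 2 * m%:R ^+ 2 + r%:R.
Definition ring_height i : R := scaled_height i / n.
Let T i : R := i%:R ^+ 2 / n.
Let F := @lnint R.
Let G i : R := F (1 - T i).

Let n_gt0 : 0 < n.
Proof. by rewrite /n -natrX -natrM -natrD ltr0n. Qed.

Let nT i : n * T i = i%:R ^+ 2.
Proof. by rewrite /T mulrC divfK// gt_eqF. Qed.

Let T_ge0 i : 0 <= T i.
Proof. by rewrite divr_ge0 ?sqr_ge0// ltW. Qed.

Let T_le i : (i <= m)%N -> T i <= 2^-1.
Proof.
move=> im; rewrite ler_pdivrMr//.
have h : i%:R ^+ 2 <= m%:R ^+ 2 :> R by rewrite lerXn2r ?nnegrE ?ler_nat.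
have r0 : 0 <= r%:R :> R by [].
by rewrite /n; lra.
Qed.

Lemma ring_height_gt0 i : 0 < ring_height i.
Proof. by rewrite divr_gt0// scaled_height_gt0. Qed.

Lemma ring_height_le i : (i < m)%N -> ring_height i <= 2^-1.
Proof.
move=> im; apply: le_trans (T_le im).
by rewrite ler_wpM2r ?scaled_height_le_sqr// invr_ge0 ltW.
Qed.

(** The square of [ring_height i] is T i * T i.+1, so this is the trapezoid rule on the
    interval from T i to T i.+1; at i = 0 it is log (1 / 4) <= -1. *)
Let ln_ring_height i : (2 * i%:R + 1) * ln (ring_height i) <= n * (F (T i.+1) - F (T i)).
Proof.
have [->|i0] := posnP i.
  rewrite mulr0 add0r mul1r /ring_height/= ln_div ?posrE// lnV ?posrE//.
  rewrite {2}/T expr0n/= mul0r /F /lnint mul0r !subr0.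
  rewrite /T expr1n mul1r lnV ?posrE// mulrBr mulrA divff ?gt_eqF// mul1r.
  have -> : ln 4 = ln 2 + ln 2 :> R by rewrite -lnM ?posrE//; congr ln; ring.
  by have := @ln2_ge R; lra.
have Ti : 0 < T i by rewrite divr_gt0// exprn_gt0// ltr0n.
have Ti1 : T i <= T i.+1.
  by rewrite ler_wpM2r ?invr_ge0 ?(ltW n_gt0)// lerXn2r ?nnegrE ?ler_nat//.
have := lnint_trapezoid Ti Ti1 => /(ler_wpM2l (ltW n_gt0)).
have -> : ln (T i) + ln (T i.+1) = 2 * ln (ring_height i).
  rewrite -lnM ?posrE//; last exact: lt_le_trans Ti1.
  have -> : T i * T i.+1 = ring_height i ^+ 2.
    rewrite /T /ring_height; case: i i0 {Ti Ti1} => // i _ /=.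
    by rewrite -[i.+2%:R]natr1; field; rewrite gt_eqF.
  by rewrite lnXn ?ring_height_gt0// mulr_natl.
apply: le_trans; rewrite le_eqVlt; apply/orP; left; apply/eqP.
transitivity ((n * T i.+1 - n * T i) * ln (ring_height i)); last by field.
by rewrite !nT -[i.+1%:R]natr1; ring.
Qed.

(** Here the trapezoid rule compares with the square root of P = (1 - T i) (1 - T i.+1), and
    (1 - s)^2 <= P + 1 / n at the height s of the ring, with P bounded away from 0. *)
Let ln_onem_ring_height i : (i < m)%N ->
  (2 * i%:R + 1) * ln (1 - ring_height i) <=
  n * (G i - G i.+1) + 2 / n * (2 * i%:R + 1).
Proof.
move=> im; have Ti := T_le (ltnW im); have Ti1 := T_le im.
have TT : T i <= T i.+1.
  by rewrite ler_wpM2r ?invr_ge0 ?(ltW n_gt0)// lerXn2r ?nnegrE ?ler_nat//.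
have li := ring_height_le im; have li0 := ring_height_gt0 i.
set P := (1 - T i.+1) * (1 - T i).
have P4 : 4^-1 <= P by rewrite /P; nra.
have P0 : 0 < P by lra.
have sqle : (1 - ring_height i) ^+ 2 <= P + n^-1.
  case: i im {Ti Ti1 TT} li li0 @P P4 P0 => [|i] im li li0 P P4 P0.
    rewrite /P /T expr1n expr0n/= mul0r subr0 mulr1 mul1r subrK.
    by rewrite expr_le1//; lra.
  rewrite le_eqVlt /P /T /ring_height/=; apply/orP; left; apply/eqP.
  by rewrite -[i.+2%:R]natr1; field; rewrite gt_eqF.
have lnle : ln (1 - ring_height i) <= ln P / 2 + 2 / n.
  have -> : ln (1 - ring_height i) = ln ((1 - ring_height i) ^+ 2) / 2.
    by rewrite lnXn; [rewrite mulr2n; field|lra].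
  have : ln ((1 - ring_height i) ^+ 2) <= ln (P + n^-1).
    rewrite ler_ln ?posrE//; first by rewrite exprn_gt0//; lra.
    by apply: addr_gt0; rewrite ?invr_gt0.
  have -> : P + n^-1 = P * (1 + n^-1 / P) by field; rewrite !gt_eqF.
  have nP : 0 < n^-1 / P by rewrite divr_gt0// invr_gt0.
  rewrite (@lnM _ P) ?posrE//; last by lra.
  have : ln (1 + n^-1 / P) <= n^-1 / P by apply: le_ln1Dx; lra.
  have : n^-1 / P <= 4 / n.
    by rewrite ler_pdivrMr// mulrAC ler_pdivlMr// mulVf ?gt_eqF//; lra.
  by move=> h1 h2 h3; lra.
have T1 : 0 < 1 - T i.+1 by lra.
have := @lnint_trapezoid _ (1 - T i.+1) (1 - T i) T1.
rewrite lerD2l lerN2 => /(_ TT) /(ler_wpM2l (ltW n_gt0)).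
rewrite -lnM ?posrE//; last by lra.
rewrite -/P.
have -> : n * ((1 - T i - (1 - T i.+1)) * ln P / 2) = (2 * i%:R + 1) * (ln P / 2).
  transitivity ((n * T i.+1 - n * T i) * (ln P / 2)); first by field.
  by rewrite !nT -[i.+1%:R]natr1; ring.
have i1 : 0 <= 2 * i%:R + 1 :> R by rewrite addr_ge0// mulr_ge0.
have := ler_wpM2l i1 lnle.
by rewrite /G /F => h1 h2; lra.
Qed.

(** The band of the equator has width r / n and n = 2 m^2 + r.  On it log stays within
    O(r / m^2) of - log 2, so the total error r^2 / m^2 is bounded.  For m = 0
    there is a single point. *)
Let equator_defect : n * (F (T m) - G m) <= r%:R * ln 2 + 13.
Proof.
have l2 := @ln2_ge R.
have [m0|m0] := posnP m.
  have r1 : r = 1%N by apply/eqP; rewrite eqn_leq; move: r_le mr_gt0; rewrite m0 /= => -> /=.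
  rewrite /G /T /n r1 m0 expr0n/= mulr0 mul0r subr0 /F /lnint ln1 mul0r; lra.
have m1 : 1 <= m%:R :> R by rewrite ler1n.
have Tm : 0 < T m by rewrite divr_gt0// exprn_gt0// ltr0n.
have TM := T_le (leqnn m).
have rm : r%:R <= 5 * m%:R :> R.
  by rewrite -natrM ler_nat (leq_trans r_le)// -[5%N]/(4 + 1)%N mulnDl leq_add2l mul1n.
have r0 : 0 <= r%:R :> R by [].
have := @lnint_tangent _ (T m) (1 - T m) Tm.
have -> : 0 < 1 - T m by lra.
move=> /(_ isT) /(ler_wpM2l (ltW n_gt0)).
have -> : n * ((1 - T m - T m) * ln (T m)) = - (r%:R * - ln (T m)).
  transitivity ((n - 2 * (n * T m)) * ln (T m)); first by ring.
  by rewrite nT /n; ring.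
rewrite -lnV ?posrE//.
have m2 : 0 < m%:R ^+ 2 :> R by rewrite exprn_gt0// ltr0n.
have -> : (T m)^-1 = 2 * (1 + r%:R / (2 * m%:R ^+ 2)).
  by rewrite /T /n; field; rewrite -/n !gt_eqF ?ltr0n.
have x0 : 0 <= r%:R / (2 * m%:R ^+ 2) :> R by rewrite divr_ge0// mulr_ge0// ltW.
rewrite lnM ?posrE//.
have h : ln (1 + r%:R / (2 * m%:R ^+ 2)) <= r%:R / (2 * m%:R ^+ 2) :> R.
  by apply: le_ln1Dx; apply: lt_le_trans x0; rewrite ltrN10.
have h2 : r%:R * ln (1 + r%:R / (2 * m%:R ^+ 2)) <= 25 / 2 :> R.
  apply: (le_trans (ler_wpM2l r0 h)).
  by rewrite mulrA ler_pdivrMr ?mulr_gt0//; nra.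
by rewrite /G /F => h3; lra.
Qed.

Definition parallels t : R :=
  \prod_(0 <= i < m) parallel (2 * i + 1) (ring_height i) t *
  parallel r 2^-1 t *
  \prod_(0 <= i < m) parallel (2 * i + 1) (1 - ring_height i) t.

Lemma parallels_sym t : parallels (1 - t) = parallels t.
Proof.
rewrite /parallels -(@parallel_sym R r 2^-1 t) (_ : 1 - 2^-1 = 2^-1); last by field.
rewrite mulrC mulrA mulrAC; congr (_ * _ * _).
  by apply: eq_bigr => i _; rewrite parallel_sym.
by apply: eq_bigr => i _; rewrite -parallel_sym; congr parallel; ring.
Qed.

Let sum_overlap_below k : (k <= m)%N ->
  \sum_(0 <= i < k) ((2 / 3) ^+ i + (2 / 3) ^+ (k.-1 - i)) <= 6 :> R.
Proof.
move=> km; rewrite big_split/= (_ : 6 = 3 + 3); last by ring.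
apply: lerD; first exact: geometric_le3.
case: k km => [|k] km; first by rewrite big_nil.
rewrite big_nat_rev/= add0n.
rewrite (eq_big_nat _ _ (F2 := fun i => (2 / 3) ^+ i)); first exact: geometric_le3.
by move=> i /= ik; rewrite subSS subKn.
Qed.

(** Bounds each factor by the exponential of a summable quantity and adds up: the quadrature
    sums telescope, the overlaps are geometric, and what remains is [equator_defect]. *)
Lemma parallels_half t : 0 <= t -> t <= 2^-1 -> expR n * parallels t <= expR 48.
Proof.
move=> t0 t2.
have lh : {homo ring_height : i j / (i <= j)%N >-> i <= j}.
  by move=> i j ij; rewrite ler_wpM2r ?invr_ge0 ?(ltW n_gt0)// scaled_height_homo.
have [k km [below above]] := threshold m t lh.
have Tk := T_le km; have Tk0 := T_ge0 k.
have k1 : 0 < 1 - T k by lra.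
have t1 : 0 <= 1 - t by lra.
(* Bounds for log t and log (1 - t) by their tangents at T k; the linear terms cancel when
   weighted by k^2 and n - k^2. *)
pose lt := ln (T k) + t / T k - 1.
pose l1 := ln (1 - T k) + (1 - t) / (1 - T k) - 1.
have l1E : 1 - t <= expR l1 by exact: le_expR_ln.
have ltE : (0 < k)%N -> t <= expR lt.
  by move=> k0; apply: le_expR_ln; rewrite divr_gt0// exprn_gt0// ltr0n.
have gibbs : k%:R ^+ 2 * lt + (n - k%:R ^+ 2) * l1 <=
    n * (F (T k) + F (1 - T k) + 1).
  rewrite -(nT k) /lt /l1 /F /lnint.
  have [k0|k0] := posnP k.
    have -> : T k = 0 by rewrite /T k0 expr0n/= mul0r.
    rewrite subr0 ln1 divr1 !mulr0 !mul0r; have := mulr_ge0 (ltW n_gt0) t0.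
    by lra.
  have Tkn : T k != 0 by rewrite gt_eqF// divr_gt0// exprn_gt0// ltr0n.
  rewrite le_eqVlt; apply/orP; left; apply/eqP; field.
  by rewrite Tkn gt_eqF.
have lev0 := ring_height_gt0.
pose o i : R := (2 / 3) ^+ i + (2 / 3) ^+ (k.-1 - i).
pose o' i : R := (2 / 3) ^+ i + (2 / 3) ^+ (m.-1 - i).
(* u1 bounds the rings below t, u2 the southern rings above t, u3 the northern rings. *)
pose u1 i := (2 * i%:R + 1) * lt + n * (G i - G i.+1) + 2 / n * (2 * i%:R + 1) + 2 * o i.
pose u2 i := (2 * i%:R + 1) * l1 + n * (F (T i.+1) - F (T i)) + 2 * (2 / 3) ^+ (i - k).
pose u3 i := (2 * i%:R + 1) * l1 + n * (G i - G i.+1) + 2 / n * (2 * i%:R + 1) + 2 * o' i.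
have natE i : (2 * i + 1)%N%:R = 2 * i%:R + 1 :> R by rewrite natrD natrM.
have P1 : 0 <= \prod_(0 <= i < k) parallel (2 * i + 1) (ring_height i) t <= expR (\sum_(0 <= i < k) u1 i).
  apply: prod_le_expR => i ik; rewrite parallel_ge0/=.
  have im : (i < m)%N by exact: leq_trans ik km.
  have k0 : (0 < k)%N by exact: leq_ltn_trans ik.
  have lev1 := ring_height_le im; have lt_i := below _ ik.
  have lk : ring_height k.-1 <= t by apply: below; rewrite prednK.
  rewrite /parallel addrC.
  apply: (@le_trans _ _ (expR ((2 * i + 1)%N%:R * (lt + ln (1 - ring_height i)) + 2 * o i))).
    apply: (@add_pow_sqrt_expR _ _ _ (scaled_height i / scaled_height k.-1)).
    - by rewrite mulr_ge0// ltW.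
    - by rewrite mulr_ge0//; lra.
    - have -> : scaled_height i / scaled_height k.-1 = ring_height i / ring_height k.-1 :> R.
        by rewrite /ring_height; field; rewrite !gt_eqF ?scaled_height_gt0.
      rewrite [leRHS]mulrAC ler_pdivlMr// -mulrA ler_wpM2l ?(ltW (lev0 _))//.
      by rewrite mulrC ler_pM ?(ltW (lev0 _))//; lra.
    - rewrite expRD ler_pM ?expR_ge0// ?ltE//; first by lra.
      by rewrite lnK ?posrE//; lra.
    - by apply: overlap_below; rewrite -ltnS prednK.
  rewrite ler_expR natE /u1; have := ln_onem_ring_height im; lra.
have P2 : 0 <= \prod_(k <= i < m) parallel (2 * i + 1) (ring_height i) t <= expR (\sum_(k <= i < m) u2 i).
  apply: prod_le_expR => i /andP[ki im]; rewrite parallel_ge0/=.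
  have lev1 := ring_height_le im.
  have tk : t <= ring_height k by apply: above; rewrite leqnn (leq_ltn_trans ki).
  have ti : t <= ring_height i by apply: above; rewrite ki.
  rewrite /parallel.
  apply: (@le_trans _ _ (expR ((2 * i + 1)%N%:R * (ln (ring_height i) + l1) + 2 * (2 / 3) ^+ (i - k)))).
    apply: (@add_pow_sqrt_expR _ _ _ (scaled_height k / scaled_height i)).
    - by rewrite mulr_ge0//; lra.
    - by rewrite mulr_ge0// ltW.
    - have -> : scaled_height k / scaled_height i = ring_height k / ring_height i :> R.
        by rewrite /ring_height; field; rewrite !gt_eqF ?scaled_height_gt0.
      rewrite mulrA mulfVK ?gt_eqF// ler_pM//; lra.
    - by rewrite expRD lnK ?posrE// ler_wpM2l// ltW.
    - exact: overlap_above.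
  rewrite ler_expR natE /u2; have := ln_ring_height i; lra.
have P3 : 0 <= parallel r 2^-1 t <= expR (r%:R * (l1 - ln 2) + 2).
  rewrite parallel_ge0/= /parallel.
  have -> : r%:R * (l1 - ln 2) + 2 = r%:R * (l1 - ln 2) + 2 * 1 by rewrite mulr1.
  apply: (@add_pow_sqrt_expR _ _ _ 1).
  - by rewrite mulr_ge0//; lra.
  - by rewrite mulr_ge0.
  - by rewrite mul1r; lra.
  - rewrite expRD mulrC ler_pM// ?invr_ge0// -lnV ?posrE// lnK// posrE invr_gt0//.
  - by rewrite /overlap subrr mulr0 oppr0 expR0.
have P4 : 0 <= \prod_(0 <= i < m) parallel (2 * i + 1) (1 - ring_height i) t <= expR (\sum_(0 <= i < m) u3 i).
  apply: prod_le_expR => i im; rewrite parallel_ge0/=.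
  have lev1 := ring_height_le im.
  have m0 : (0 < m)%N by exact: leq_ltn_trans im.
  rewrite /parallel.
  apply: (@le_trans _ _ (expR ((2 * i + 1)%N%:R * (ln (1 - ring_height i) + l1) + 2 * o' i))).
    apply: (@add_pow_sqrt_expR _ _ _ (scaled_height i / scaled_height m.-1)).
    - by rewrite mulr_ge0//; have := lev0 i; lra.
    - by rewrite mulr_ge0//; lra.
    - rewrite (_ : 1 - (1 - ring_height i) = ring_height i); last by ring.
      have q2 : 2 * ring_height i <= scaled_height i / scaled_height m.-1.
        have lm : 2 * scaled_height m.-1 <= n.
          have := @scaled_height_le_sqr R m.-1; rewrite prednK// => lm.
          by have : 0 <= r%:R :> R by []; rewrite /n; lra.
        rewrite ler_pdivlMr ?scaled_height_gt0// /ring_height.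
        have -> : 2 * (scaled_height i / n) * scaled_height m.-1 = scaled_height i * (2 * scaled_height m.-1) / n by ring.
        by rewrite ler_pdivrMr// ler_wpM2l// ltW// scaled_height_gt0.
      apply: (@le_trans _ _ (2 * ring_height i * ((1 - ring_height i) * (1 - t)))).
        have h : t <= 2 * ((1 - ring_height i) * (1 - t)) by nra.
        have -> : 2 * ring_height i * ((1 - ring_height i) * (1 - t)) =
          ring_height i * (2 * ((1 - ring_height i) * (1 - t))) by ring.
        by rewrite mulrC ler_wpM2l// ltW.
      by rewrite ler_wpM2r// mulr_ge0//; lra.
    - rewrite expRD ler_pM//; first by lra.
      by rewrite lnK ?posrE//; lra.
    - by apply: overlap_below; rewrite -ltnS prednK.
  rewrite ler_expR natE /u3; have := ln_onem_ring_height im; lra.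
have kmr : k%:R ^+ 2 <= m%:R ^+ 2 :> R by rewrite lerXn2r ?nnegrE ?ler_nat.
have sumG (a b : nat) : (a <= b)%N -> \sum_(a <= i < b) (G i - G i.+1) = G a - G b.
  move=> ab; rewrite -[RHS]opprB -(telescope_sumr G ab) -sumrN.
  by apply: eq_bigr => i _; rewrite opprB.
have U1 : \sum_(0 <= i < k) u1 i <= k%:R ^+ 2 * lt + n * (G 0%N - G k) + 13.
  rewrite /u1 !big_split/= -mulr_suml -!mulr_sumr sum_odd sumG//.
  have := sum_overlap_below km; rewrite -/o => So.
  have : 2 / n * k%:R ^+ 2 <= 1.
    rewrite mulrAC ler_pdivrMr// mul1r /n; have : 0 <= r%:R :> R by [].
    lra.
  by lra.
have U2 : \sum_(k <= i < m) u2 i <=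
    (m%:R ^+ 2 - k%:R ^+ 2) * l1 + n * (F (T m) - F (T k)) + 6.
  rewrite /u2 !big_split/= -mulr_suml -!mulr_sumr telescope_sumr//.
  have -> : \sum_(k <= i < m) (2 * i%:R + 1) = m%:R ^+ 2 - k%:R ^+ 2 :> R.
    rewrite -(sum_odd m) -(sum_odd k) (@big_cat_nat _ _ _ k 0 m)//=; by rewrite addrAC subrr add0r.
  have : \sum_(k <= i < m) (2 / 3) ^+ (i - k) <= 3 :> R.
    rewrite -{1}[k]add0n big_addn.
    rewrite (eq_bigr (fun i => (2 / 3) ^+ i)); first exact: geometric_le3.
    by move=> i _; rewrite addnK.
  by lra.
have U3 : \sum_(0 <= i < m) u3 i <= m%:R ^+ 2 * l1 + n * (G 0%N - G m) + 13.
  rewrite /u3 !big_split/= -mulr_suml -!mulr_sumr sum_odd sumG//.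
  have := sum_overlap_below (leqnn m); rewrite -/o' => So.
  have : 2 / n * m%:R ^+ 2 <= 1.
    rewrite mulrAC ler_pdivrMr// mul1r /n; have : 0 <= r%:R :> R by [].
    lra.
  by lra.
rewrite /parallels (@big_cat_nat _ _ _ k 0 m)//=.
move/andP: P1 => [p1 P1]; move/andP: P2 => [p2 P2].
move/andP: P3 => [p3 P3]; move/andP: P4 => [p4 P4].
apply: (@le_trans _ _ (expR n * (expR (\sum_(0 <= i < k) u1 i) * expR (\sum_(k <= i < m) u2 i)
    * expR (r%:R * (l1 - ln 2) + 2) * expR (\sum_(0 <= i < m) u3 i)))).
  rewrite ler_pM2l ?expR_gt0//.
  by do !(apply: ler_pM => //; rewrite ?mulr_ge0//).
rewrite -!expRD ler_expR.
have GE : G 0%N = -1.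
  by rewrite /G /T expr0n/= mul0r subr0 /F /lnint ln1 mulr0 sub0r.
have Gk : F (1 - T k) = G k by [].
have eqd := equator_defect.
have nE : n = 2 * m%:R ^+ 2 + r%:R by [].
rewrite GE in U1 U3; rewrite Gk in gibbs.
(* The exponent 48 exceeds 13 + 6 + 2 + 13 from the four products and 13 from the equator. *)
have : (n - k%:R ^+ 2) * l1 = (m%:R ^+ 2 - k%:R ^+ 2) * l1 + r%:R * l1 + m%:R ^+ 2 * l1.
  by rewrite nE; ring.
lra.
Qed.

End Flatness.

(** * Points of the plane realizing the rings *)

Section Points.
Context {R : realType}.

Lemma normcX (z : R[i]) k : normc (z ^+ k) = normc z ^+ k.
Proof. by elim: k => [|k IH]; rewrite ?expr0 ?normc1// !exprS normcM IH. Qed.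

Lemma normc_ge0 (z : R[i]) : 0 <= normc z.
Proof. by case: z => x y; exact: sqrtr_ge0. Qed.

Lemma normc_real (x : R) : 0 <= x -> normc (x%:C)%C = x.
Proof. by move=> x0; rewrite /normc/= expr0n/= addr0 sqrtr_sqr ger0_norm. Qed.

(** The vertices of the polygon are the roots of X^r - rho^r. *)
Lemma circle_roots (r : nat) (rho : R) : (0 < r)%N -> 0 < rho ->
  exists s : seq R[i], [/\ size s = r, {in s, forall w, normc w = rho} &
    forall z, \prod_(w <- s) normc (z - w) <= normc z ^+ r + rho ^+ r].
Proof.
move=> r0 rho0; have rhor0 : 0 <= rho ^+ r by rewrite exprn_ge0// ltW.
pose a : R[i] := ((rho ^+ r)%:C)%C.
pose p : {poly R[i]} := 'X^r - a%:P.
have [s ps] := closed_field_poly_normal p.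
have pm : lead_coef p = 1 := lead_coefXnsubC a r0.
rewrite pm scale1r in ps.
exists s; split.
- have := size_XnsubC a r0; rewrite -/p ps size_prod_XsubC => -[].
  by [].
- move=> w ws; have : root p w by rewrite ps root_prod_XsubC.
  rewrite /root /p !hornerE subr_eq0 => /eqP wa.
  have : normc w ^+ r = rho ^+ r by rewrite -normcX wa normc_real.
  by move/eqP; rewrite eqrXn2// ?normc_ge0 ?ltW// => /eqP.
- move=> z.
  have -> : \prod_(w <- s) normc (z - w) = normc p.[z].
    rewrite ps horner_prod (big_morph _ (@normcM R) (@normc1 R)).
    by apply: eq_bigr => w _; rewrite hornerXsubC.
  rewrite /p !hornerE; apply: le_trans (le_normcD _ _) _.
  by rewrite normcN normcX normc_real.
Qed.

Definition height (z : R[i]) : R := sqn (plane z) / (1 + sqn (plane z)).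

(** The radius rho of the parallel at height tau satisfies rho^2 = tau / (1 - tau). *)
Lemma parallel_points (r : nat) (tau : R) : 0 < tau -> tau < 1 ->
  exists s : seq R[i], size s = r /\
    forall z, \prod_(w <- s) chord2 (plane w) (plane z) <= parallel r tau (height z).
Proof.
move=> t0 t1; have [->|r0] := posnP r.
  by exists [::]; split => // z; rewrite big_nil /parallel !expr0; lra.
have s0 : 0 < tau / (1 - tau) by rewrite divr_gt0// subr_gt0.
have [s [sr srho sz]] : exists s : seq R[i], [/\ size s = r,
    {in s, forall w, normc w = Num.sqrt (tau / (1 - tau))} &
    forall z, \prod_(w <- s) normc (z - w) <= normc z ^+ r + Num.sqrt (tau / (1 - tau)) ^+ r].
  by apply: circle_roots; rewrite ?sqrtr_gt0.
set rho := Num.sqrt _ in srho sz.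
exists s; split => // z; set P := sqn (plane z).
have P0 : 0 <= P by exact: sqn_ge0.
have P1 : 0 < 1 + P by lra.
have tn : 1 - tau != 0 by rewrite gt_eqF// subr_gt0.
have q (w : R[i]) : w \in s -> 1 + sqn (plane w) = (1 - tau)^-1.
  by move=> /srho wr; rewrite -normc_sqn wr sqr_sqrtr ?ltW//; field.
pose k := (1 - height z) * (1 - tau).
have hz : 1 - height z = (1 + P)^-1 by rewrite /height -/P; field; rewrite gt_eqF.
have k0 : 0 <= k by rewrite /k hz mulr_ge0 ?invr_ge0; lra.
have -> : \prod_(w <- s) chord2 (plane w) (plane z) =
    (\prod_(w <- s) normc (z - w)) ^+ 2 * k ^+ r.
  rewrite -prodrXl -sr -[X in k ^+ X]count_predT -iter_mulr_1 -big_const_seq -big_split/=.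
  apply: eq_big_seq => w /q wq; rewrite /chord2 wq /k hz normc_sqn.
  have -> : plane (z - w) = ((plane z).1 - (plane w).1, (plane z).2 - (plane w).2).
    by case: (z) => x y; case: (w) => u v.
  by rewrite -/P; field; rewrite tn gt_eqF.
apply: (@le_trans _ _ ((normc z ^+ r + rho ^+ r) ^+ 2 * k ^+ r)).
  rewrite ler_wpM2r ?exprn_ge0// lerXn2r ?nnegrE ?prodr_ge0 ?addr_ge0 ?exprn_ge0 ?normc_ge0 ?sqrtr_ge0//.
  by move=> w _; exact: normc_ge0.
have kr : k ^+ r = (Num.sqrt k ^+ r) ^+ 2 by rewrite -exprM mulnC exprM sqr_sqrtr.
rewrite kr -exprMn mulrDl -!exprMn /parallel le_eqVlt; apply/orP; left; apply/eqP.
congr ((_ ^+ _ + _ ^+ _) ^+ _).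
- rewrite -[normc z]ger0_norm ?normc_ge0// -sqrtr_sqr -sqrtrM ?sqr_ge0//.
  congr Num.sqrt; rewrite normc_sqn -/P /k hz /height -/P; field; rewrite gt_eqF//.
- rewrite -sqrtrM ?ltW//; congr Num.sqrt; rewrite /k; field.
  by rewrite gt_eqF// subr_gt0.
Qed.

Definition realizable (M : nat) (f : R -> R) : Prop :=
  exists s : seq R[i], size s = M /\
    forall z, \prod_(w <- s) chord2 (plane w) (plane z) <= f (height z).

Lemma realizableM M1 M2 f1 f2 : realizable M1 f1 -> realizable M2 f2 ->
  realizable (M1 + M2) (fun t => f1 t * f2 t).
Proof.
move=> [s1 [size1 h1]] [s2 [size2 h2]].
exists (s1 ++ s2); split; first by rewrite size_cat size1 size2.
move=> z; rewrite big_cat/=; apply: ler_pM => //;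
  by apply: prodr_ge0 => w _; exact: chord2_ge0.
Qed.

Lemma realizable_prod (m : nat) (tau : nat -> R) :
  (forall i, (i < m)%N -> 0 < tau i < 1) ->
  realizable (m ^ 2) (fun t => \prod_(0 <= i < m) parallel (2 * i + 1) (tau i) t).
Proof.
elim: m => [|m IH] tau01.
  by exists [::]; split => // z; rewrite !big_nil.
have /andP[t0 t1] := tau01 m (ltnSn m).
have := realizableM (IH (fun i im => tau01 i (leqW im))) (parallel_points (2 * m + 1) t0 t1).
have -> : (m ^ 2 + (2 * m + 1) = m.+1 ^ 2)%N by rewrite -!mulnn; lia.
move=> [s [sm h]]; exists s; split => // z.
by rewrite big_nat_recr//=.
Qed.

Lemma double_square_remainder (N : nat) :
  exists m r : nat, N = (2 * m ^ 2 + r)%N /\ (r <= 4 * m + 1)%N.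
Proof.
elim: N => [|N [m [r [-> rm]]]]; first by exists 0%N, 0%N.
have [rlt|] := ltnP r (4 * m + 1); first by exists m, r.+1; rewrite addnS.
move=> rge; exists m.+1, 0%N; split => //; rewrite -!mulnn; lia.
Qed.

(** The constant 24 is half of the exponent in [parallels_half], because the potential is half
    of the logarithm of the product. *)
Lemma flat_configuration (N : nat) : (0 < N)%N ->
  exists w : 'I_N -> R[i], forall z,
    \prod_(i < N) (expR 1 * chord2 (plane (w i)) (plane z)) <= expR 24 ^+ 2.
Proof.
have [m [r [-> rm]]] := double_square_remainder N => N0.
have lev i : (i < m)%N -> 0 < (ring_height m r i : R) < 1.
  move=> im; apply/andP; split; first exact: ring_height_gt0.
  by have := @ring_height_le R _ _ N0 _ im; lra.
have lev' i : (i < m)%N -> 0 < 1 - (ring_height m r i : R) < 1.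
  by move=> /lev /andP[a b]; apply/andP; split; lra.
have half : 0 < 2^-1 :> R by lra.
have half1 : 2^-1 < 1 :> R by lra.
have := realizableM (realizableM (realizable_prod lev) (parallel_points r half half1))
  (realizable_prod lev').
have -> : (m ^ 2 + r + m ^ 2 = 2 * m ^ 2 + r)%N by lia.
set M := (2 * m ^ 2 + r)%N in N0 *.
move=> [s [sM h]]; exists (fun i => nth 0 s i) => z.
have ME : M%:R = 2 * m%:R ^+ 2 + r%:R :> R by rewrite natrD natrM natrX.
rewrite big_split/= prodr_const card_ord -expRM_natl mulr1 -expRM_natl.
have -> : 2%:R * 24 = 48 :> R by ring.
rewrite -(big_mkord xpredT (fun i => chord2 (plane (nth 0 s i)) (plane z))) -sM.
rewrite -(big_nth 0 xpredT (fun w => chord2 (plane w) (plane z))) sM.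
apply: (@le_trans _ _ (expR M%:R * parallels m r (height z))).
  by rewrite ler_pM2l ?expR_gt0// h.
have P0 : 0 <= sqn (plane z) by exact: sqn_ge0.
have h0 : 0 <= height z by rewrite divr_ge0//; lra.
have h1 : height z <= 1 by rewrite ler_pdivrMr; lra.
rewrite ME; have [hz|hz] := leP (height z) 2^-1; first exact: parallels_half.
by rewrite -parallels_sym; apply: parallels_half => //; lra.
Qed.

End Points.

Theorem theorem2p1p1 (R : realType) :
  (forall N : nat, (1 <= N)%N -> packing_number N (0 : R) = 1%E) /\
  (exists2 K : R, 1 < K &
     forall (N : nat) (beta : R), (1 <= N)%N -> 0 < beta ->
       (1 <= packing_number N beta)%E /\
       (packing_number N beta <= (K `^ beta)%:E)%E).
Proof.
split; first by move=> N _; exact: packing_zero.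
exists (expR 24); first by rewrite expR_gt1.
move=> N beta N0 beta0; split; first exact: packing_lb.
have [w flat] := @flat_configuration R N N0.
by apply: (packing_ub beta0 _ flat); exact: expR_ge0.
Qed.
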